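(* Let $\mathbf{M}$ be a countable structure in a signature $\mathcal{L}$, which is an atomic model of its first-order theory. Suppose that $\mathbf{N}$ is an expansion of $\mathbf{M}$ in a signature $\mathcal{L}'$, and that $\mathbf{N}$ is full. Denote $G = \mathrm{Aut}(\mathbf{M})$ and $H = \mathrm{Aut}(\mathbf{N})$. Then $$\mathrm{Sa}(G/H) \cong \mathrm{Exp}(\mathbf{M}, \mathbf{N})$$ as $G$-flows.
   Context: Expansions. Let $\mathcal{L}'\supseteq\mathcal{L}$ be signatures (relation and function symbols, possibly uncountably many), where the new symbols are also allowed to apply to imaginary sorts (sorts of the form $\theta/\varepsilon$, quotients of a quantifier-free definable set of tuples by a quantifier-free definable equivalence relation). An $\mathcal{L}'$-expansion of an $\mathcal{L}$-structure $\mathbf{M}$ is an $\mathcal{L}'$-structure $\mathbf{N}$ (countable) with a map $\iota\colon M\to N$ such that: $\iota$ is an $\mathcal{L}$-embedding; $N=\mathrm{dcl}^{\mathcal{L}'}(\iota[M])$; and $\iota[M]$ is $\mathrm{Aut}(\mathbf{N})$-invariant. Here $\mathrm{dcl}(A)$ is the set of $b$ such that $\{b\}$ is definable with parameters from $A$. (So $N$ may contain new elements.) Restriction to $\iota[M]$ identifies $\mathrm{Aut}(\mathbf{N})$ topologically with a closed subgroup $H$ of $G=\mathrm{Aut}(\mathbf{M})$; automorphism groups carry the pointwise convergence topology. $\mathbf{N}$ is full if for every $k$, every $\mathrm{Aut}(\mathbf{N})$-invariant subset of $N^k$ is definable in $\mathbf{N}$ by a first-order formula without parameters. A model is atomic if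 it realizes only isolated types. $\mathrm{Exp}(\mathbf{M},\mathbf{N})=\{p\in\mathrm{S}_\omega(\mathrm{Th}(\mathbf{N})) : p|_{\mathcal{L}}=\mathrm{tp}_{\mathcal{L}}\,\bar a\}$, where $\bar a$ is a fixed enumeration of $\mathbf{M}$, $\mathrm{S}_\omega$ is the compact space of complete types in variables indexed by this enumeration (the inverse limit of the spaces $\mathrm{S}_k$), and $p|_{\mathcal{L}}$ is the restriction of $p$ to $\mathcal{L}$-formulas; the type $\mathrm{tp}_{\mathcal{L}}\,\bar a$ is taken for $\bar a$ in $\mathbf{M}$. Identifying variables with elements of $M$, $G$ acts on $\mathrm{Exp}(\mathbf{M},\mathbf{N})$ by permuting the variables. Samuel compactification. For closed $H\le G$, $G/H$ carries the uniformity with basic entourages $\{(gH,vgH):v\in V,g\in G\}$, $V$ a symmetric open neighborhood of $1_G$. $\mathrm{Sa}(G/H)$ is the Gelfand space of the algebra of bounded uniformly continuous functions on $G/H$, with the $G$-action extending left translation.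
   Formalization: In Exp(M,N), the restriction of p to L is read with quantifiers of L-formulas relativized to ι[M] inside N; read literally the claim fails when N has new elements (e.g. L empty, M of two points, N with one extra named point). For ι onto the two readings agree. *)

(* Defs.v *)
From HB Require Import structures.
From mathcomp Require Import all_boot all_order all_algebra.
From mathcomp Require Import all_classical all_reals all_analysis.
From mathcomp Require Import complex.

Set Implicit Arguments.
Unset Strict Implicit.
Unset Printing Implicit Defensive.

Import Order.TTheory GRing.Theory Num.Theory numFieldNormedType.Exports.

Local Open Scope classical_set_scope.
Local Open Scope ring_scope.

Lemma dep_funext A (B : A -> Type) (f g : forall a, B a) :
  (forall a, f a = g a) -> f = g.
Proof. exact: functional_extensionality_dep. Qed.

Section FunctionAlgebra.
Variables (T : pointedType) (R : comNzRingType).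

Let fct_scalerAl (a : R) (f g : T -> R^o) : a *: (f * g) = (a *: f) * g.
Proof. by apply/funext => x; exact: scalerAl. Qed.

HB.instance Definition _ :=
  GRing.Lmodule_isLalgebra.Build R (T -> R^o) fct_scalerAl.

End FunctionAlgebra.

Section BoundedUniformlyContinuous.
Variables (K : numFieldType) (X : puniformType).

Definition bdd_ucont : {pred (X -> K^o)} := [pred f : X -> K^o |
  `[< (exists B : K, forall x, `|f x| <= B) /\ unif_continuous f >]].

Lemma unif_continuousE (f : X -> K^o) : unif_continuous f <->
  forall e : K, 0 < e -> entourage [set xy | `|f xy.1 - f xy.2| < e].
Proof.
split=> [uf e e0|uf E].
  apply: (uf [set xy : K^o * K^o | `|xy.1 - xy.2| < e]).
  by rewrite -entourage_ballE; exists e => // -[x y].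
rewrite -entourage_ballE => -[e e0 eE].
by apply: filterS (uf e e0) => -[x y] /= xy; apply: (eE (f x, f y)).
Qed.

Let bdd_ucont1 : 1 \in bdd_ucont.
Proof.
apply/asboolP; split; first by exists 1 => x; rewrite normr1.
apply/unif_continuousE => e e0; apply: filterS filterT => -[x y] _ /=.
by rewrite subrr normr0.
Qed.

Let bdd_ucontD f g : f \in bdd_ucont -> g \in bdd_ucont -> f + g \in bdd_ucont.
Proof.
move=> /asboolP[[B fB] /unif_continuousE uf].
move=> /asboolP[[C gC] /unif_continuousE ug].
apply/asboolP; split.
  by exists (B + C) => x; rewrite (le_trans (ler_normD _ _))// lerD.
apply/unif_continuousE => e e0.
have e2 : 0 < e / 2 by rewrite divr_gt0.
apply: filterS (filterI (uf _ e2) (ug _ e2)) => -[x y] /= [fxy gxy].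
rewrite -[(f + g) x]/(f x + g x) -[(f + g) y]/(f y + g y) opprD addrACA.
by rewrite (le_lt_trans (ler_normD _ _))// [e]splitr ltrD.
Qed.

Let bdd_ucontM f g : f \in bdd_ucont -> g \in bdd_ucont -> f * g \in bdd_ucont.
Proof.
move=> /asboolP[[B fB] /unif_continuousE uf].
move=> /asboolP[[C gC] /unif_continuousE ug].
have B0 : 0 <= B by exact: le_trans (fB point).
have C0 : 0 <= C by exact: le_trans (gC point).
apply/asboolP; split.
  by exists (B * C) => x; rewrite normrM ler_pM.
apply/unif_continuousE => e e0.
pose D := B + C + 1.
have D0 : 0 < D by rewrite ltr_wpDl// addr_ge0.
have eD : 0 < e / D by rewrite divr_gt0.
apply: filterS (filterI (uf _ eD) (ug _ eD)) => -[x y] /= [fxy gxy].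
rewrite -[(f * g) x]/(f x * g x) -[(f * g) y]/(f y * g y).
have -> : f x * g x - f y * g y = f x * (g x - g y) + (f x - f y) * g y.
  by rewrite mulrBr mulrBl addrA subrK.
rewrite (le_lt_trans (ler_normD _ _))// !normrM.
have h1 : `|f x| * `|g x - g y| <= B * (e / D) by rewrite ler_pM// ltW.
have h2 : `|f x - f y| * `|g y| <= C * (e / D).
  by rewrite mulrC ler_pM// ltW.
rewrite (le_lt_trans (lerD h1 h2))// -mulrDl mulrCA -[ltRHS]mulr1.
by rewrite ltr_pM2l// ltr_pdivrMr// mul1r ltrDl.
Qed.

Let bdd_ucont_cst (a : K) : cst a \in bdd_ucont.
Proof.
apply/asboolP; split; first by exists `|a| => x.
apply/unif_continuousE => e e0; apply: filterS filterT => -[x y] _ /=.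
by rewrite subrr normr0.
Qed.

Let bdd_ucont_subproof : GRing.subalg_closed bdd_ucont.
Proof.
split=> [|a f g fA gA|f g]; [exact: bdd_ucont1| |exact: bdd_ucontM].
by apply: bdd_ucontD => //; exact: (@bdd_ucontM (cst a) f).
Qed.

HB.instance Definition _ :=
  GRing.isSubalgClosed.Build K (X -> K^o) bdd_ucont
    (GRing.subalg_closed_semi bdd_ucont_subproof).

Record buc := Buc { buc_fun :> X -> K^o; buc_funP : buc_fun \in bdd_ucont }.

HB.instance Definition _ := [isSub for buc_fun].
HB.instance Definition _ := [Choice of buc by <:].
HB.instance Definition _ := [SubChoice_isSubLalgebra of buc by <:].

End BoundedUniformlyContinuous.

(* The Gelfand space of the algebra of bounded uniformly continuous functions:
   unital algebra morphisms to the scalars, with pointwise convergence. *)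
Definition samuel (K : numFieldType) (X : puniformType) : Type :=
  {lrmorphism buc K X -> K | *%R}.

HB.instance Definition _ K X := gen_eqMixin (samuel K X).
HB.instance Definition _ K X := gen_choiceMixin (samuel K X).
HB.instance Definition _ K X := Topological.copy (samuel K X)
  (@initial_topology _ {ptws buc K X -> K}
     (fun (chi : samuel K X) (f : buc K X) => chi f : K)).

(* Many-sorted first-order logic with equality.  The argument places of a symbol
   form a finite type, each place having a sort. *)
Record signature := Signature {
  sorts : Type;
  fsym : Type;
  fplace : fsym -> finType;
  fdom : forall f, fplace f -> sorts;
  fcod : fsym -> sorts;
  rsym : Type;
  rplace : rsym -> finType;
  rdom : forall r, rplace r -> sorts }.

Section Syntax.
Variable S : signature.

Record structure := Structure {
  carrier :> sorts S -> Type;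
  fint : forall f, (forall i, carrier (@fdom S f i)) -> carrier (fcod f);
  rint : forall r, (forall i, carrier (@rdom S r i)) -> Prop }.

(* [X s] is the type of the variables of sort [s] that may occur free. *)
Inductive term (X : sorts S -> Type) : sorts S -> Type :=
| Var s : X s -> term X s
| App f : (forall i, term X (@fdom S f i)) -> term X (fcod f).

Inductive extend (X : sorts S -> Type) (s0 : sorts S) : sorts S -> Type :=
| Fresh : extend X s0 s0
| Old s : X s -> extend X s0 s.

Inductive formula (X : sorts S -> Type) : Type :=
| Falsum
| Equal s of term X s & term X s
| Rel r of (forall i, term X (@rdom S r i))
| Imp of formula X & formula X
| All s of formula (extend X s).

Definition Neg X (phi : formula X) := Imp phi (Falsum X).
Definition Conj X (phi psi : formula X) := Neg (Imp phi (Neg psi)).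

Fixpoint quantifier_free X (phi : formula X) : Prop :=
  match phi with
  | Imp phi psi => quantifier_free phi /\ quantifier_free psi
  | All _ _ => False
  | _ => True
  end.

(* The context in which all variables, indexed by [V], have sort [s0]. *)
Inductive vars (s0 : sorts S) (V : Type) : sorts S -> Type :=
| var of V : vars s0 V s0.

Definition sentence := formula (fun=> void).

Definition renaming (X Y : sorts S -> Type) := forall s, X s -> Y s.

Definition lift_renaming X Y (rho : renaming X Y) s0 :
    renaming (extend X s0) (extend Y s0) :=
  fun s x => match x with
             | Fresh => Fresh Y s0
             | Old s x => Old s0 (rho s x)
             end.

Fixpoint rename_term X Y (rho : renaming X Y) s (t : term X s) : term Y s :=
  match t with
  | Var s x => Var (rho s x)
  | App f a => App (fun i => rename_term rho (a i))
  end.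

Fixpoint rename X Y (rho : renaming X Y) (phi : formula X) : formula Y :=
  match phi with
  | Falsum => Falsum Y
  | Equal s t u => Equal (rename_term rho t) (rename_term rho u)
  | Rel r a => Rel (fun i => rename_term rho (a i))
  | Imp phi psi => Imp (rename rho phi) (rename rho psi)
  | All s phi => All (rename (lift_renaming rho (s0 := s)) phi)
  end.

Definition map_vars s0 V W (f : V -> W) : renaming (vars s0 V) (vars s0 W) :=
  fun s x => match x with var v => var s0 (f v) end.

End Syntax.

Section Semantics.
Variables (S : signature) (M : structure S).

Definition valuation (X : sorts S -> Type) := forall s, X s -> M s.

Definition push X s0 (c : M s0) (v : valuation X) : valuation (extend X s0) :=
  fun s x => match x with
             | Fresh => c
             | Old s x => v s x
             end.

Definition assign s0 V (a : V -> M s0) : valuation (vars s0 V) :=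
  fun s x => match x with var v => a v end.

Fixpoint term_eval X (v : valuation X) s (t : term X s) : M s :=
  match t with
  | Var s x => v s x
  | App f a => fint (fun i => term_eval v (a i))
  end.

Fixpoint sat X (phi : formula X) : valuation X -> Prop :=
  match phi with
  | Falsum => fun=> False
  | Equal s t u => fun v => term_eval v t = term_eval v u
  | Rel r a => fun v => rint (fun i => term_eval v (a i))
  | Imp phi psi => fun v => sat phi v -> sat psi v
  | All s phi => fun v => forall c : M s, sat phi (push c v)
  end.

Definition theory : set (sentence S) :=
  [set phi | sat phi (fun _ => of_void _)].

Definition tp s0 V (a : V -> M s0) : set (formula (vars s0 V)) :=
  [set phi | sat phi (assign a)].

Definition definable s0 V (D : set (V -> M s0)) :=
  exists phi : formula (vars s0 V), D = [set a | sat phi (assign a)].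

(* In [phi] the variable [None] stands for the element being defined and
   [Some i] for the [i]-th parameter. *)
Definition dcl s0 (A : set (M s0)) : set (M s0) :=
  [set b | exists k (c : 'I_k -> M s0) (phi : formula (vars s0 (option 'I_k))),
    (forall i, A (c i)) /\ forall y, sat phi (assign (oapp c y)) <-> y = b].

Record automorphism := Automorphism {
  aut_fun :> forall s, M s -> M s;
  aut_inv : forall s, M s -> M s;
  aut_funK : forall s, cancel (@aut_fun s) (@aut_inv s);
  aut_invK : forall s, cancel (@aut_inv s) (@aut_fun s);
  aut_fint : forall f (a : forall i, M (@fdom S f i)),
    aut_fun (fint a) = fint (fun i => aut_fun (a i));
  aut_rint : forall r (a : forall i, M (@rdom S r i)),
    rint (fun i => aut_fun (a i)) <-> rint a }.

Lemma automorphism_eq (g h : automorphism) :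
  (forall s, g s =1 h s) -> g = h.
Proof.
case: g h => [g g' gK g'K gf gr] [h h' hK h'K hf hr] /= gh.
have e : g = h by apply: dep_funext => s; exact/funext/gh.
subst h; have e : g' = h'.
  apply: dep_funext => s; apply/funext => x.
  by rewrite -{1}[x](h'K s) gK.
by subst h'; congr Automorphism; exact: Prop_irrelevance.
Qed.

Definition aut1 : automorphism :=
  @Automorphism (fun=> id) (fun=> id) (fun _ _ => erefl) (fun _ _ => erefl)
    (fun _ _ => erefl) (fun _ _ => iff_refl _).

Section Composition.
Variables g h : automorphism.

Let autM_funK s : cancel (g s \o h s) (@aut_inv h s \o @aut_inv g s).
Proof. by move=> x /=; rewrite !aut_funK. Qed.

Let autM_invK s : cancel (@aut_inv h s \o @aut_inv g s) (g s \o h s).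
Proof. by move=> x /=; rewrite !aut_invK. Qed.

Let autM_fint f (a : forall i, M (@fdom S f i)) :
  (g _ \o h _) (fint a) = fint (fun i => (g _ \o h _) (a i)).
Proof. by rewrite /= !aut_fint. Qed.

Let autM_rint r (a : forall i, M (@rdom S r i)) :
  rint (fun i => (g _ \o h _) (a i)) <-> rint a.
Proof. by split=> [/aut_rint/aut_rint|/aut_rint ?] //; exact/aut_rint. Qed.

Definition autM := Automorphism autM_funK autM_invK autM_fint autM_rint.

Let invK I (e : I -> sorts S) (a : forall i, M (e i)) :
  (fun i => g _ (aut_inv g (a i))) = a.
Proof. by apply: dep_funext => i; rewrite aut_invK. Qed.

Let autV_fint f (a : forall i, M (@fdom S f i)) :
  aut_inv g (fint a) = fint (fun i => aut_inv g (a i)).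
Proof. by rewrite -{1}[a]invK -aut_fint aut_funK. Qed.

Let autV_rint r (a : forall i, M (@rdom S r i)) :
  rint (fun i => aut_inv g (a i)) <-> rint a.
Proof. by rewrite -{2}[a]invK; split=> /aut_rint. Qed.

Definition autV := Automorphism (@aut_invK g) (@aut_funK g) autV_fint autV_rint.

End Composition.

End Semantics.

HB.instance Definition _ S (M : structure S) := gen_eqMixin (automorphism M).
HB.instance Definition _ S (M : structure S) := gen_choiceMixin (automorphism M).

(* The group law is composition; the topology is pointwise convergence, each
   sort being discrete. *)
Section AutomorphismGroup.
Variables (S : signature) (M : structure S).
Implicit Types g h v : automorphism M.

Let mulA : associative (@autM S M).
Proof. by move=> g h v; exact: automorphism_eq. Qed.

Let mul1 : left_id (aut1 M) (@autM S M).
Proof. by move=> g; exact: automorphism_eq. Qed.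

Let mulr1 : right_id (aut1 M) (@autM S M).
Proof. by move=> g; exact: automorphism_eq. Qed.

Let mulV : left_inverse (aut1 M) (@autV S M) (@autM S M).
Proof. by move=> g; apply: automorphism_eq => s x; exact: aut_funK. Qed.

Let mulrV : right_inverse (aut1 M) (@autV S M) (@autM S M).
Proof. by move=> g; apply: automorphism_eq => s x; exact: aut_invK. Qed.

HB.instance Definition _ := isGroup.Build (automorphism M)
  mulA mul1 mulr1 mulV mulrV.

Definition agree k (a : 'I_k -> {s & M s}) g h :=
  forall i, g (tag (a i)) (tagged (a i)) = h (tag (a i)) (tagged (a i)).

Definition pointwise_open (V : set (automorphism M)) :=
  forall g, V g -> exists k (a : 'I_k -> {s & M s}), agree a g `<=` V.

Let openT : pointwise_open setT.
Proof.
have a : 'I_0 -> {s & M s} by case.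
by move=> g _; exists 0%N, a.
Qed.

Let openI : setI_closed pointwise_open.
Proof.
move=> U V oU oV g [/oU[k [a aU]] /oV[l [b bV]]].
exists (k + l)%N, (fun i => match fintype.split i with inl i => a i | inr i => b i end).
move=> h gh; split; [apply: aU => i|apply: bV => i].
- by have := gh (lshift l i); rewrite (unsplitK (inl i)).
- by have := gh (rshift k i); rewrite (unsplitK (inr i)).
Qed.

Let open_bigU (I : Type) (f : I -> set (automorphism M)) :
  (forall i, pointwise_open (f i)) -> pointwise_open (\bigcup_i f i).
Proof.
move=> fo g [i _ /fo[k [a af]]]; exists k, a => h gh.
by exists i => //; exact: af.
Qed.

HB.instance Definition _ := isOpenTopological.Build (automorphism M)
  openT openI open_bigU.

End AutomorphismGroup.

Section CosetSpace.
Variables (S : signature) (M : structure S) (H : set (automorphism M)).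
Local Notation G := (automorphism M).

Record coset_space := CosetSpace {
  coset_set : set G;
  coset_setP : exists g, coset_set = [set (g * h)%g | h in H] }.

HB.instance Definition _ := gen_eqMixin coset_space.
HB.instance Definition _ := gen_choiceMixin coset_space.

Lemma coset_space_eq (C D : coset_space) : coset_set C = coset_set D -> C = D.
Proof.
by case: C D => [C ?] [D ?] /= CD; subst D; congr CosetSpace; exact: Prop_irrelevance.
Qed.

Definition lcoset g : coset_space := CosetSpace (ex_intro _ g erefl).

HB.instance Definition _ := isPointed.Build coset_space (lcoset 1%g).

Let translate_subproof g (C : coset_space) :
  exists k, [set (g * x)%g | x in coset_set C] = [set (k * h)%g | h in H].
Proof.
case: C => _ /= [k ->]; exists (g * k)%g; rewrite image_comp.
by apply: eq_imagel => h _ /=; rewrite mulgA.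
Qed.

Definition translate g C := CosetSpace (translate_subproof g C).

Lemma translateM g h C : translate (g * h)%g C = translate g (translate h C).
Proof.
apply: coset_space_eq => /=; rewrite image_comp.
by apply: eq_imagel => x _ /=; rewrite mulgA.
Qed.

Lemma translate1 C : translate 1%g C = C.
Proof.
apply: coset_space_eq => /=; rewrite -[RHS]image_id.
by apply: eq_imagel => x _; rewrite mul1g.
Qed.

Lemma translate_lcoset g h : translate g (lcoset h) = lcoset (g * h)%g.
Proof.
apply: coset_space_eq => /=; rewrite image_comp.
by apply: eq_imagel => x _ /=; rewrite mulgA.
Qed.

Definition coset_entourage : set_system (coset_space * coset_space) :=
  [set E | exists V : set G,
    [/\ open V, V 1%g, (forall v, V v -> V v^-1%g) &
        forall v g, V v -> E (lcoset g, lcoset (v * g)%g)]].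

Lemma coset_entourageE E : coset_entourage E <-> exists V : set G,
  [/\ open V, V 1%g, (forall v, V v -> V v^-1%g) &
      forall v C, V v -> E (C, translate v C)].
Proof.
split=> -[V [oV V1 VV VE]]; exists V; split=> //.
  move=> v C Vv; suff [g ->] : exists g, C = lcoset g.
    by rewrite translate_lcoset; exact: VE.
  by case: (coset_setP C) => g Cg; exists g; exact: coset_space_eq.
by move=> v g Vv; have := VE v (lcoset g) Vv; rewrite translate_lcoset.
Qed.

Let entourageF : Filter coset_entourage.
Proof.
split.
- by exists setT; split=> //; exact: openT.
- move=> E F [V [oV V1 VV VE]] [W [oW W1 WW WF]].
  exists (V `&` W); split=> //; first exact: openI.
    by move=> v [/VV ? /WW].
  by move=> v g [Vv Ww]; split; [exact: VE|exact: WF].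
- move=> E F EF [V [oV V1 VV VE]]; exists V; split=> // v g Vv.
  by apply: EF; exact: VE.
Qed.

Let entourage_diag E : coset_entourage E -> diagonal `<=` E.
Proof.
move=> /coset_entourageE[V [_ V1 _ VE]] [C D] /= CD.
have -> : D = C by [].
by move: (VE _ C V1); rewrite translate1.
Qed.

Let entourage_inv E : coset_entourage E -> coset_entourage E^-1%relation.
Proof.
move=> /coset_entourageE[V [oV V1 VV VE]]; apply/coset_entourageE.
exists V; split=> // v C Vv.
have /= := VE v^-1%g (translate v C) (VV _ Vv).
by rewrite -translateM mulVg translate1.
Qed.

Let entourage_split E : coset_entourage E ->
  exists2 F, coset_entourage F & (F \; F `<=` E)%relation.
Proof.
move=> /coset_entourageE[V [oV V1 VV VE]].
have [k [a aV]] : exists k (a : 'I_k -> {s & M s}), agree a 1%g `<=` V.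
  by have [k [a aV]] := oV _ V1; exists k, a.
pose W : set G := agree a 1%g.
have WV v : W v -> W v^-1%g.
  move=> Wv i; apply: etrans (esym (aut_funK v _)) _.
  by congr (aut_inv v _); exact: esym (Wv i).
have WM v w : W v -> W w -> W (v * w)%g.
  by move=> Wv Ww i; apply: etrans (Wv i) _; congr (v _ _); exact: Ww.
exists [set CD | exists2 v, W v & CD.2 = translate v CD.1].
  apply/coset_entourageE; exists W; split=> //; last by move=> v C Wv; exists v.
  by move=> w Ww; exists k, a => x wx i; rewrite -wx; exact: Ww.
move=> [C D] /= [B [v Wv /= ->] [w Ww /= ->]].
by rewrite -translateM; apply/VE/aV/WM.
Qed.

HB.instance Definition _ := isUniform.Build coset_space
  entourageF entourage_diag entourage_inv entourage_split.

Lemma translate_unif_continuous g : unif_continuous (translate g).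
Proof.
move=> E /coset_entourageE[V [oV V1 VV VE]]; apply/coset_entourageE.
exists [set v | V (g * v * g^-1)%g]; split.
- move=> v Vv; have [k [a aV]] := oV _ Vv.
  exists k, (fun i => Tagged M (g^-1%g (tag (a i)) (tagged (a i)))) => w vw.
  by apply: aV => i /=; congr (g _ _); exact: vw.
- by rewrite /= mulg1 mulgV.
- by move=> v /= /VV; rewrite !invgM invgK mulgA.
- move=> v C /= Vv; have /= := VE _ (translate g C) Vv.
  by rewrite -!translateM -mulgA mulVg mulg1.
Qed.

End CosetSpace.

Section SamuelPoint.
Variables (K : numFieldType) (X : puniformType) (x : X).

Definition buc_eval (f : buc K X) : K := f x.

Let buc_eval_zmod : {morph buc_eval : f g / f - g}.
Proof. by []. Qed.

Let buc_eval_monoid : GRing.monoid_morphism buc_eval.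
Proof. by []. Qed.

Let buc_eval_scalable : scalable_for *%R buc_eval.
Proof. by []. Qed.

HB.instance Definition _ := GRing.isZmodMorphism.Build _ _ buc_eval buc_eval_zmod.
HB.instance Definition _ :=
  GRing.isMonoidMorphism.Build _ _ buc_eval buc_eval_monoid.
HB.instance Definition _ :=
  GRing.isScalable.Build _ _ _ _ buc_eval buc_eval_scalable.

Definition samuel_point : samuel K X := buc_eval.

End SamuelPoint.

Section SamuelAction.
Variables (K : numFieldType) (X : puniformType) (t : X -> X).
Hypothesis ut : unif_continuous t.

Let buc_comp_subproof (f : buc K X) :
  (f : X -> K^o) \o t \in bdd_ucont (K := K) (X := X).
Proof.
case: f => f /= /asboolP[[B fB] uf]; apply/asboolP; split.
  by exists B => x; exact: fB.
by move=> E /uf /ut.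
Qed.

Definition buc_comp (f : buc K X) : buc K X := Buc (buc_comp_subproof f).

Let buc_comp_zmod : {morph buc_comp : f g / f - g}.
Proof. by move=> f g; apply: val_inj. Qed.

Let buc_comp_monoid : GRing.monoid_morphism buc_comp.
Proof. by split=> [|f g]; apply: val_inj. Qed.

Let buc_comp_scalable : scalable buc_comp.
Proof. by move=> a f; apply: val_inj. Qed.

HB.instance Definition _ := GRing.isZmodMorphism.Build _ _ buc_comp buc_comp_zmod.
HB.instance Definition _ := GRing.isMonoidMorphism.Build _ _ buc_comp buc_comp_monoid.
HB.instance Definition _ := GRing.isScalable.Build _ _ _ _ buc_comp buc_comp_scalable.

Definition samuel_map (chi : samuel K X) : samuel K X := chi \o buc_comp.

Lemma samuel_map_point x :
  samuel_map (samuel_point K x) =1 samuel_point K (t x).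
Proof. by []. Qed.

End SamuelAction.

Definition samuel_act (K : numFieldType) S (M : structure S)
    (H : set (automorphism M)) (g : automorphism M) :
    samuel K (coset_space H) -> samuel K (coset_space H) :=
  samuel_map (@translate_unif_continuous S M H g).

Lemma samuel_actM (K : numFieldType) S (M : structure S)
    (H : set (automorphism M)) g h (chi : samuel K (coset_space H)) :
  samuel_act (g * h)%g chi =1 samuel_act g (samuel_act h chi).
Proof.
move=> f /=; congr (chi _); apply: val_inj; apply/funext => C /=.
by rewrite translateM.
Qed.

Section Types.
Variables (S : signature) (T : set (sentence S)) (s0 : sorts S) (V : Type).
Local Notation form := (formula (vars s0 V)).

Definition consistent (p : set form) :=
  forall n (phi : 'I_n -> form), (forall i, p (phi i)) ->
    exists (K : structure S) (a : V -> K s0),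
      T `<=` theory K /\ forall i, tp a (phi i).

(* The complete types of [T] in the variables [V] of sort [s0]. *)
Definition complete_type (p : set form) :=
  consistent p /\ forall phi, p phi \/ p (Neg phi).

Definition isolated_type (p : set form) :=
  exists2 phi, p phi & forall q, complete_type q -> q phi -> q = p.

Record types := Types {
  type_set :> set form;
  type_setP : complete_type type_set }.

HB.instance Definition _ := gen_eqMixin types.
HB.instance Definition _ := gen_choiceMixin types.

(* The sets of the types containing a given formula form a base. *)
Definition logic_open (A : set types) :=
  forall p, A p -> exists2 phi, (p : set form) phi &
    [set q : types | (q : set form) phi] `<=` A.

Lemma types_eq (p q : types) : p = q :> set form -> p = q.
Proof.
by case: p q => [p ?] [q ?] /= pq; subst p; congr Types; exact: Prop_irrelevance.
Qed.

Lemma complete_type_Neg (p : set form) phi : complete_type p ->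
  p (Neg phi) <-> ~ p phi.
Proof.
move=> [cp mp]; split=> [pN pp|np]; last by have [/np|] := mp phi.
have [|K [a [_ h]]] := cp 2%N (fun i => if i == 0 :> nat then phi else Neg phi).
  by move=> [[|i] ?].
exact: (h (@Ordinal 2 1 isT)) (h (@Ordinal 2 0 isT)).
Qed.

Lemma complete_type_Conj (p : set form) phi psi : complete_type p ->
  p (Conj phi psi) <-> p phi /\ p psi.
Proof.
move=> ctp; have [cp mp] := ctp; split=> [pC|[p1 p2]].
  split; apply: contrapT => /(complete_type_Neg _ ctp) pN.
  - have [|K [a [_ h]]] := cp 2%N
      (fun i => if i == 0 :> nat then Conj phi psi else Neg phi).
      by move=> [[|i] ?].
    have h0 : sat (Conj phi psi) (assign a) := h (@Ordinal 2 0 isT).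
    apply: h0 => /= h1.
    by case: (h (@Ordinal 2 1 isT) h1).
  - have [|K [a [_ h]]] := cp 2%N
      (fun i => if i == 0 :> nat then Conj phi psi else Neg psi).
      by move=> [[|i] ?].
    have h0 : sat (Conj phi psi) (assign a) := h (@Ordinal 2 0 isT).
    apply: h0 => /= _ h1.
    by case: (h (@Ordinal 2 1 isT) h1).
have [//|pN] := mp (Conj phi psi).
have [|K [a [_ h]]] := cp 3%N (fun i => if i == 0 :> nat then phi
    else if i == 1 :> nat then psi else Neg (Conj phi psi)).
  by move=> [[|[|i]] ?].
have h2 : sat (Neg (Conj phi psi)) (assign a) := h (@Ordinal 3 2 isT).
case: h2 => /= h2; exact: h2 (h (@Ordinal 3 0 isT)) (h (@Ordinal 3 1 isT)).
Qed.

Let openT : logic_open setT.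
Proof.
move=> p _; exists (Neg (Falsum _)) => //.
apply/(complete_type_Neg _ (type_setP p)) => pF.
by have [|K [a [_ /(_ ord0)]]] := (type_setP p).1 1%N (fun=> Falsum _).
Qed.

Let openI : setI_closed logic_open.
Proof.
move=> A B oA oB p [/oA[phi pphi phiA] /oB[psi ppsi psiB]].
exists (Conj phi psi); first exact/(complete_type_Conj _ _ (type_setP p)).
move=> q /(complete_type_Conj _ _ (type_setP q))[q1 q2].
by split; [exact: phiA|exact: psiB].
Qed.

Let open_bigU (I : Type) (f : I -> set types) :
  (forall i, logic_open (f i)) -> logic_open (\bigcup_i f i).
Proof.
move=> fo p [i _ /fo[phi pphi phif]]; exists phi => // q qphi.
by exists i => //; exact: phif.
Qed.

HB.instance Definition _ := isOpenTopological.Build types openT openI open_bigU.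

End Types.

Section Renaming.
Variables (S : signature) (M : structure S).

Lemma term_eval_rename X Y (rho : renaming X Y) (v : valuation M Y) s
    (t : term X s) :
  term_eval v (rename_term rho t) = term_eval (fun s x => v s (rho s x)) t.
Proof.
elim: t => //= f a IH; congr fint.
by apply: dep_funext => i; exact: IH.
Qed.

Lemma sat_rename X Y (rho : renaming X Y) (phi : formula X)
    (v : valuation M Y) :
  sat (rename rho phi) v <-> sat phi (fun s x => v s (rho s x)).
Proof.
elim: phi Y rho v => {X} [X|X s t u|X r a|X phi IH psi JH|X s phi IH] Y rho v //=.
- by rewrite !term_eval_rename.
- suff -> : (fun i => term_eval v (rename_term rho (a i))) =
    (fun i => term_eval (fun s x => v s (rho s x)) (a i)) by [].
  by apply: dep_funext => i; exact: term_eval_rename.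
- by split=> h /IH/h/JH.
- have e c : (fun s' x => push c v (lift_renaming rho (s0 := s) x)) =
      push c (fun s x => v s (rho s x)).
    apply: dep_funext => s'.
    by apply: dep_funext => -[|].
  by split=> h c; [have /IH := h c; rewrite e|apply/IH; rewrite e; exact: h].
Qed.

End Renaming.


Section TypeComap.
Variables (S : signature) (T : set (sentence S)) (s0 : sorts S) (V W : Type).

Let type_comap_subproof (f : V -> W) (p : types T s0 W) :
  complete_type T [set phi : formula (vars s0 V) |
    (p : set _) (rename (map_vars f) phi)].
Proof.
have [cp mp] := type_setP p; split=> [n phi /cp[K [a [TK Ka]]]|phi].
  exists K, (a \o f); split=> // i; have /sat_rename := Ka i.
  congr sat; apply: dep_funext => s.
  by apply: dep_funext => -[].
exact: mp (rename (map_vars f) phi).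
Qed.

(* Restriction of types along a map of variables. *)
Definition type_comap f p := Types (type_comap_subproof f p).

End TypeComap.

Section Languages.

Record language := Language {
  lfsym : Type;
  lfar : lfsym -> nat;
  lrsym : Type;
  lrar : lrsym -> nat }.

Variable L : language.

Definition one_sorted : signature :=
  @Signature unit (lfsym L) (fun f => 'I_(lfar f)) (fun _ _ => tt) (fun=> tt)
    (lrsym L) (fun r => 'I_(lrar r)) (fun _ _ => tt).

Definition lformula V := @formula one_sorted (@vars one_sorted tt V).

Definition lsat (M : structure one_sorted) V (phi : lformula V) (a : V -> M tt) :=
  sat phi (@assign one_sorted M tt V a).

(* theta/eps, for [im_dom] = theta and [im_eqv] = eps. *)
Record imaginary := Imaginary {
  im_ar : nat;
  im_dom : lformula 'I_im_ar;
  im_eqv : lformula ('I_im_ar + 'I_im_ar);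
  im_dom_qf : quantifier_free im_dom;
  im_eqv_qf : quantifier_free im_eqv }.

(* A language extending [L]: its imaginary sorts and its new symbols, whose
   places and values have the home sort ([None]) or an imaginary sort. *)
Record extension := Extension {
  isort : Type;
  isort_def : isort -> imaginary;
  xfsym : Type;
  xfar : xfsym -> nat;
  xfdom : forall f, 'I_(xfar f) -> option isort;
  xfcod : xfsym -> option isort;
  xrsym : Type;
  xrar : xrsym -> nat;
  xrdom : forall r, 'I_(xrar r) -> option isort }.

Variable E : extension.

(* For each imaginary sort [i], of the form theta/eps with [k]-ary theta, the
   symbol [inr i] is the graph of the quotient map: its places are [Some j],
   [j : 'I_k], of home sort, and [None], of sort [i]. *)
Definition expanded : signature :=
  @Signature (option (isort E))
    (lfsym L + xfsym E)
    (fun f => match f with inl f => 'I_(lfar f) | inr f => 'I_(xfar f) end)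
    (fun f => match f with inl _ => fun=> None | inr f => @xfdom E f end)
    (fun f => match f with inl _ => None | inr f => xfcod f end)
    (lrsym L + xrsym E + isort E)
    (fun r => match r with
              | inl (inl r) => 'I_(lrar r)
              | inl (inr r) => 'I_(xrar r)
              | inr i => option 'I_(im_ar (isort_def i))
              end)
    (fun r => match r with
              | inl (inl _) => fun=> None
              | inl (inr r) => @xrdom E r
              | inr i => fun j => if j is Some _ then None else Some i
              end).

Definition hformula V := @formula expanded (@vars expanded None V).

Definition hsat (N : structure expanded) V (phi : hformula V) (a : V -> N None) :=
  sat phi (@assign expanded N None V a).

Definition reduct (N : structure expanded) : structure one_sorted :=
  @Structure one_sorted (fun=> N None)
    (fun f a => @fint expanded N (inl f) a)
    (fun r a => @rint expanded N (inl (inl r)) a).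

Section ImaginarySorts.
Variables (N : structure expanded) (i : isort E).
Local Notation k := (im_ar (isort_def i)).

Definition in_dom (a : 'I_k -> N None) :=
  lsat (M := reduct N) (im_dom (isort_def i)) a.

Definition in_eqv (a b : 'I_k -> N None) :=
  lsat (M := reduct N) (im_eqv (isort_def i))
    (fun j => match j with inl j => a j | inr j => b j end).

Definition class_of (a : 'I_k -> N None) (c : N (Some i)) :=
  @rint expanded N (inr i)
    (fun j => match j with Some j => a j | None => c end).

Record is_quotient : Prop := IsQuotient {
  quotient_refl : forall a, in_dom a -> in_eqv a a;
  quotient_sym : forall a b, in_dom a -> in_dom b -> in_eqv a b -> in_eqv b a;
  quotient_trans : forall a b c, in_dom a -> in_dom b -> in_dom c ->
    in_eqv a b -> in_eqv b c -> in_eqv a c;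
  class_dom : forall a c, class_of a c -> in_dom a;
  class_total : forall a, in_dom a -> exists c, class_of a c;
  class_surj : forall c, exists a, class_of a c;
  class_eq : forall a b c d, class_of a c -> class_of b d ->
    (c = d <-> in_eqv a b) }.

End ImaginarySorts.

(* Relativization of [L]-formulas to the subset defined by [U]; the variables
   of sort [tt] become variables of the home sort. *)
Section Relativization.
Variable U : hformula unit.

Definition home_renaming (X : unit -> Type) (Y : option (isort E) -> Type) :=
  forall s, X s -> Y None.

Definition home_lift X Y (rho : home_renaming X Y) s0 :
    home_renaming (@extend one_sorted X s0) (@extend expanded Y None) :=
  fun s x => match x with
             | Fresh => @Fresh expanded Y None
             | Old s x => @Old expanded Y None None (rho s x)
             end.

Fixpoint home_term X Y (rho : home_renaming X Y) s
    (t : @term one_sorted X s) : @term expanded Y None :=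
  match t with
  | Var s x => @Var expanded Y None (rho s x)
  | App f a => @App expanded Y (inl f) (fun i => home_term rho (a i))
  end.

Definition fresh_renaming Y :
    @renaming expanded (@vars expanded None unit) (@extend expanded Y None) :=
  fun s x => match x with var _ => @Fresh expanded Y None end.

Fixpoint relativize X Y (rho : home_renaming X Y)
    (phi : @formula one_sorted X) : @formula expanded Y :=
  match phi with
  | Falsum => @Falsum expanded Y
  | Equal s t u => @Equal expanded Y None (home_term rho t) (home_term rho u)
  | Rel r a => @Rel expanded Y (inl (inl r)) (fun i => home_term rho (a i))
  | Imp phi psi => @Imp expanded Y (relativize rho phi) (relativize rho psi)
  | All s phi => @All expanded Y None
      (Imp (rename (@fresh_renaming Y) U) (relativize (@home_lift X Y rho s) phi))
  end.

End Relativization.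

End Languages.

Section RenamingLemmas.
Variable S : signature.

Lemma lift_renaming_comp (X Y Z : sorts S -> Type) (rho : renaming X Y)
    (sigma : renaming Y Z) s0 :
  (fun s x => lift_renaming sigma (s0 := s0) (lift_renaming rho x)) =
  lift_renaming (fun s x => sigma s (rho s x)) (s0 := s0) :> renaming _ _.
Proof. by apply: dep_funext => s; apply: dep_funext => -[]. Qed.

Lemma rename_term_comp (X Y Z : sorts S -> Type) (rho : renaming X Y)
    (sigma : renaming Y Z) s (t : term X s) :
  rename_term sigma (rename_term rho t) =
  rename_term (fun s x => sigma s (rho s x)) t.
Proof.
by elim: t => //= f a IH; congr App; apply: dep_funext => i; exact: IH.
Qed.

Lemma rename_comp (X Y Z : sorts S -> Type) (rho : renaming X Y)
    (sigma : renaming Y Z) (phi : formula X) :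
  rename sigma (rename rho phi) = rename (fun s x => sigma s (rho s x)) phi.
Proof.
elim: phi Y Z rho sigma => {X} [X|X s t u|X r a|X phi IH psi JH|X s phi IH]
  Y Z rho sigma //=.
- by rewrite !rename_term_comp.
- by congr Rel; apply: dep_funext => i; exact: rename_term_comp.
- by rewrite IH JH.
- by rewrite IH lift_renaming_comp.
Qed.

Variable M : structure S.

Lemma term_eval_aut (g : automorphism M) X (v : valuation M X) s (t : term X s) :
  term_eval (fun s x => g s (v s x)) t = g s (term_eval v t).
Proof.
elim: t => //= f a IH; rewrite aut_fint; congr fint.
by apply: dep_funext => i; exact: IH.
Qed.

Lemma sat_aut (g : automorphism M) X (phi : formula X) (v : valuation M X) :
  sat phi (fun s x => g s (v s x)) <-> sat phi v.
Proof.
elim: phi v => {X} [X|X s t u|X r a|X phi IH psi JH|X s phi IH] v //=.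
- by rewrite !term_eval_aut; split=> [/(can_inj (aut_funK g (s := s)))|->].
- rewrite (_ : (fun i => _) = (fun i => g _ (term_eval v (a i)))) ?aut_rint//.
  by apply: dep_funext => i; exact: term_eval_aut.
- by split=> h /IH/h/JH.
- have e c : push (g s c) (fun s x => g s (v s x)) =
      (fun s' x => g s' (push c v x)).
    by apply: dep_funext => s'; apply: dep_funext => -[].
  split=> h c; first by apply/IH; rewrite -e.
  by rewrite -[c](aut_invK g) e; apply/IH.
Qed.

End RenamingLemmas.

Section RelativizationLemmas.
Variables (L : language) (E : extension L).
Variable U : hformula E unit.
Local Notation L1 := (one_sorted L).
Local Notation L2 := (expanded E).

Lemma rename_home_term X Y Z (rho : home_renaming X Y) (sigma : @renaming L2 Y Z) s
    (t : @term L1 X s) :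
  rename_term sigma (home_term rho t) =
  home_term (fun s x => sigma None (rho s x)) t.
Proof.
by elim: t => //= f a IH; apply: (congr1 (@App L2 Z (inl f))); apply: dep_funext => i; exact: IH.
Qed.

Lemma rename_relativize X Y Z (rho : home_renaming X Y) (sigma : @renaming L2 Y Z)
    (phi : @formula L1 X) :
  rename sigma (relativize U rho phi) =
  relativize U (fun s x => sigma None (rho s x)) phi.
Proof.
elim: phi Y Z rho sigma => {X} [X|X s t u|X r a|X phi IH psi JH|X s phi IH]
  Y Z rho sigma //=.
- by rewrite !rename_home_term.
- by apply: (congr1 (@Rel L2 Z (inl (inl r)))); apply: dep_funext => i; exact: rename_home_term.
- by rewrite IH JH.
- rewrite IH rename_comp.
  have -> : (fun s' x => lift_renaming sigma (s0 := None) (fresh_renaming Y x)) =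
      @fresh_renaming L E Z.
    by apply: dep_funext => s'; apply: dep_funext => -[].
  have -> // : (fun s' x => lift_renaming sigma (s0 := None) (home_lift rho x)) =
      @home_lift L E _ _ (fun s x => sigma None (rho s x)) s.
  by apply: dep_funext => s'; apply: dep_funext => -[].
Qed.

Lemma home_term_rename X Y Z (tau : @renaming L1 X Y) (rho : home_renaming Y Z) s
    (t : @term L1 X s) :
  home_term rho (rename_term tau t) =
  home_term (E := E) (fun s x => rho s (tau s x)) t.
Proof.
by elim: t => //= f a IH; apply: (congr1 (@App L2 Z (inl f))); apply: dep_funext => i; exact: IH.
Qed.

Lemma relativize_rename X Y Z (tau : @renaming L1 X Y) (rho : home_renaming Y Z)
    (phi : @formula L1 X) :
  relativize U rho (rename tau phi) =
  relativize U (fun s x => rho s (tau s x)) phi.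
Proof.
elim: phi Y Z rho tau => {X} [X|X s t u|X r a|X phi IH psi JH|X s phi IH]
  Y Z rho tau //=.
- by rewrite !home_term_rename.
- by apply: (congr1 (@Rel L2 Z (inl (inl r)))); apply: dep_funext => i; exact: home_term_rename.
- by rewrite IH JH.
- rewrite IH.
  have -> // : (fun s' x => home_lift rho (lift_renaming tau (s0 := s) x)) =
      @home_lift L E _ _ (fun s x => rho s (tau s x)) s.
  by apply: dep_funext => s'; apply: dep_funext => -[].
Qed.

End RelativizationLemmas.

Definition atomic L (M : structure (one_sorted L)) :=
  forall k (a : 'I_k -> M tt), isolated_type (theory M) (tp a).

Section Expansion.
Variables (L : language) (E : extension L).
Variables (M : structure (one_sorted L)) (N : structure (expanded E)).

Definition full :=
  forall k (D : set ('I_k -> N None)),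
    (forall (h : automorphism N) a, D (fun i => h None (a i)) <-> D a) ->
    definable (M := N) (s0 := None) D.

Variable iota : M tt -> N None.

Record embedding : Prop := Embedding {
  embedding_inj : injective iota;
  embedding_fint : forall (f : lfsym L) (a : 'I_(lfar f) -> M tt),
    iota (@fint (one_sorted L) M f a) =
    @fint (one_sorted L) (reduct N) f (iota \o a);
  embedding_rint : forall (r : lrsym L) (a : 'I_(lrar r) -> M tt),
    @rint (one_sorted L) (reduct N) r (iota \o a) <->
    @rint (one_sorted L) M r a }.

Record expansion : Prop := Expansion {
  expansion_countable : countable [set: N None];
  expansion_sorts : forall i : isort E, is_quotient N i;
  expansion_embedding : embedding;
  expansion_dcl : dcl (M := N) (s0 := None) (range iota) = setT;
  expansion_invariant : forall h : automorphism N,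
    [set h None b | b in range iota] = range iota }.

(* The automorphisms of [M] induced by those of [N]. *)
Definition aut_expansion : set (automorphism M) :=
  [set g | exists h : automorphism N, forall a, h None (iota a) = iota (g tt a)].

Local Notation Ntypes := (@types (expanded E) (theory N) None (M tt)).

Definition home_vars V :
    home_renaming (@vars (one_sorted L) tt V) (@vars (expanded E) None V) :=
  fun s x => match x with var v => @var (expanded E) None V v end.

(* The restriction of [p] to [L]-formulas.  An [L]-formula speaks about [M], so
   in [N] its quantifiers range over the copy [iota M] of [M], which [U] defines:
   since [N] may have elements outside [iota M], only with this reading does the
   type in [N] of the enumeration of [iota M] restrict to the type in [M] of the
   enumeration of [M].  When [iota] is onto, the relativized formula is equivalent
   in [N] to the formula itself. *)
Definition restrict_type (U : hformula E unit) (p : Ntypes) :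
    set (lformula L (M tt)) :=
  [set phi | type_set p (relativize U (@home_vars (M tt)) phi)].

Definition defines_range (U : hformula E unit) :=
  forall b : N None, hsat U (fun=> b) <-> range iota b.

(* The variables are indexed by the elements of [M], so that the enumeration of
   [M] is the identity. *)
Definition Exp : set Ntypes :=
  [set p | exists2 U, defines_range U &
    restrict_type U p = tp (@id (M tt))].

Let Exp_act_subproof (g : automorphism M) (p : Exp) :
  type_comap (g^-1%g tt) (val p) \in Exp.
Proof.
case: p => p pE; apply/mem_set; case: (set_mem pE) => U UM pM; exists U => //.
apply/seteqP; split=> phi; rewrite /restrict_type/= rename_relativize.
all: have -> : (fun s (x : @vars (one_sorted L) tt (M tt) s) =>
    map_vars (S := expanded E) (g^-1%g tt) (home_vars x)) =
  (fun s x => home_vars (map_vars (S := one_sorted L) (g^-1%g tt) x)).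
1,3: by apply: dep_funext => s; apply: dep_funext => -[].
all: rewrite -relativize_rename.
all: rewrite -[type_set p _]/(restrict_type U p _) pM /tp /= sat_rename.
all: have -> : (fun s x => assign (M := M) id (map_vars (g^-1%g tt) x)) =
  (fun s x => g^-1%g s (assign (M := M) (s0 := tt) id x)).
1,3: by apply: dep_funext => s; apply: dep_funext => -[].
all: by move/sat_aut.
Qed.

(* [phi(x_a)] belongs to [g p] iff [phi(x_(g^-1 a))] belongs to [p]. *)
Definition Exp_act (g : automorphism M) (p : Exp) : Exp :=
  SigSub (Exp_act_subproof g p).

Lemma Exp_actM g h p : Exp_act (g * h)%g p = Exp_act g (Exp_act h p).
Proof.
apply: val_inj; apply: types_eq; apply/funext => phi /=.
rewrite rename_comp; congr (type_set _ (rename _ _)).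
by apply: dep_funext => s; apply: dep_funext => -[].
Qed.

End Expansion.

Definition isomorphic_actions (G : Type) (X Y : topologicalType)
    (actX : G -> X -> X) (actY : G -> Y -> Y) :=
  exists (f : X -> Y) (f' : Y -> X),
    [/\ cancel f f', cancel f' f, continuous f, continuous f' &
        forall g x, f (actX g x) = actY g (f x)].

(* Main.v *)
Require Import Defs.
From HB Require Import structures.
From mathcomp Require Import all_boot all_order all_algebra.
From mathcomp Require Import all_classical all_reals all_analysis.
From mathcomp Require Import complex ring lra.

(** Write [X] for [G/H].  Each [g] in [G] gives a point of [Exp M N]: the type
    in [N] of the family indexed by [M] whose entry at [a] is
    [iota (g^-1 a)].  Elements of [H] come from automorphisms of [N], so this
    type depends on the coset [gH] only, and every formula [phi] of the expanded
    language in variables indexed by [M] cuts out a subset [[phi]] of [X], the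
    cosets realizing [phi].  Three facts relate these subsets to [Exp M N] and
    to the uniformity of [X].

    Density ([Exp_realized]): if [p] is in [Exp M N] and contains [phi], then
    [[phi]] is not empty.  Let [c] be the tuple of the variables of [phi].  As
    [M] is atomic, an [L]-formula isolates the type of [c]; relativized to
    [iota M] it belongs to [p], so [N] realizes it together with [phi] by a tuple
    [iota d].  Then [c] and [d] have the same type in [M], and a countable atomic
    structure is homogeneous, so [d = g^-1 c] for some [g] in [G].

    Continuity ([realizes_fixes]): [phi] mentions finitely many variables [c],
    so [[phi]] is a union of orbits of the pointwise stabilizer of [c].  Hence
    its indicator function is uniformly continuous.

    Definability ([saturated_definable]): conversely, a union of orbits of the
    stabilizer of a finite tuple [c] is some [[phi]], because it is determined by
    a set of tuples [iota (g^-1 c)] invariant under [Aut N], which is definable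
    by fullness.

    Let [p] be in [Exp M N].  By density the sets [[phi]], [phi] in [p], generate
    a proper filter on [X].  Along it every bounded uniformly continuous [f] has a
    limit ([type_limit]): divide the range of [f] into finitely many small pieces
    and saturate their preimages; these sets are definable and cover [X], so the
    complete type [p] contains one of them.  Limits are compatible with the
    algebra operations, so [p] yields a character of the algebra.

    Conversely, a character [chi] sends the idempotent indicator of [[phi]] to
    [0] or [1], and the [phi] sent to [1] form a type in [Exp M N].  The character
    is recovered as the limit along that type: otherwise [f - chi f] would stay
    away from [0] on some [[phi]] with [chi] equal to [1] on its indicator, which
    would make this indicator a multiple of [f - chi f], an element of the kernel.

    Both maps are continuous because a value of a character is, up to any error,
    decided by one formula, and the type of a character is read off from its
    values on indicators.  Equivariance holds since translating the indicator of
    [[phi]] amounts to renaming the variables of [phi]. *)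

Set Implicit Arguments.
Unset Strict Implicit.
Unset Printing Implicit Defensive.

Import Order.TTheory GRing.Theory Num.Theory numFieldNormedType.Exports.

Local Open Scope classical_set_scope.
Local Open Scope ring_scope.
Local Open Scope complex_scope.

(** * Formulas have finitely many variables *)

Section FiniteSupport.
Variable S : signature.

(** The free variables of a formula are recorded by a finite family that may
    have void entries: going under a quantifier then only erases the entries
    for the bound variable, and no index type has to be recomputed. *)
Record family (X : sorts S -> Type) := Family {
  family_index : finType;
  member :> family_index -> option {s & X s} }.

Definition agree_on (X : sorts S -> Type) (M : structure S)
    (F : family X) (v w : valuation M X) :=
  forall i s x, F i = Some (Tagged X x) -> v s x = w s x.

Definition family_sum X (J : finType) (F : J -> family X) :=
  Family (fun u : {j : J & family_index (F j)} => F (tag u) (tagged u)).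

Lemma agree_on_sum X (M : structure S) (J : finType) (F : J -> family X)
    (v w : valuation M X) :
  agree_on (family_sum F) v w -> forall j, agree_on (F j) v w.
Proof.
by move=> vw j i s x Fi; exact: (vw (Tagged (fun j => family_index (F j)) i)).
Qed.

Arguments agree_on_sum {X M J F v w} _ j _ _ _ _.

Lemma term_support X s (t : term X s) : exists F : family X,
  forall (M : structure S) (v w : valuation M X),
  agree_on F v w -> term_eval v t = term_eval w t.
Proof.
elim: t => [{}s x|f a /choice[F FP]].
  exists (Family (fun _ : unit => Some (Tagged X x))).
  by move=> M v w /(_ tt) /=; exact.
exists (family_sum F) => M v w vw /=.
by congr fint; apply: dep_funext => i; apply: (FP i _ v w (agree_on_sum vw i)).
Qed.

Definition old_var (X : sorts S -> Type) s0 (u : {s & extend X s0 s}) :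
    option {s & X s} :=
  match u with
  | existT _ x => match x with
                  | Fresh => None
                  | Old s x => Some (Tagged X x)
                  end
  end.

Lemma formula_support X (phi : formula X) : exists F : family X,
  forall (M : structure S) (v w : valuation M X),
  agree_on F v w -> sat phi v <-> sat phi w.
Proof.
elim: phi => {X} [X|X s t u|X r a|X phi [F FP] psi [G GP]|X s phi [F FP]].
- by exists (Family (of_void _)).
- have [F FP] := term_support t; have [G GP] := term_support u.
  exists (family_sum (fun b : bool => if b then F else G)) => M v w vw /=.
  by rewrite (FP _ v w (agree_on_sum vw true)) (GP _ v w (agree_on_sum vw false)).
- have /choice[F FP] := fun i => term_support (a i).
  exists (family_sum F) => M v w vw /=.
  suff -> : (fun i => term_eval v (a i)) = (fun i => term_eval w (a i)) by [].
  by apply: dep_funext => i; apply: (FP i _ v w (agree_on_sum vw i)).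
- exists (family_sum (fun b : bool => if b then F else G)) => M v w vw /=.
  by rewrite (FP _ v w (agree_on_sum vw true)) (GP _ v w (agree_on_sum vw false)).
- exists (Family (fun j => obind (@old_var X s) (F j))) => M v w vw /=.
  suff e c : sat phi (push c v) <-> sat phi (push c w).
    by split=> h c; apply/e.
  apply: FP => j s' [//|{}s' x] cj /=; apply: (vw j).
  by rewrite /= cj.
Qed.

Variables (s0 : sorts S).

Definition ord0_elim T (i : 'I_0) : T := False_rect T (notF (ltn_ord i)).

(** The form in which finiteness of supports is used: the variables of [phi] are
    among the [c i], and [r] collapses all variables onto these, so that
    renaming along [r] turns [phi] into a formula in finitely many variables that
    [a \o c] satisfies if and only if [a] satisfies [phi]. *)
Lemma formula_retract V (phi : formula (vars s0 V)) :
  exists k (c : 'I_k -> V) (r : V -> 'I_k),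
  forall (M : structure S) (a : V -> M s0),
  sat phi (assign a) <-> sat phi (assign (a \o c \o r)).
Proof.
have [[v0]|V0] := pselect (inhabited V); last first.
  exists 0%N, (@ord0_elim V).
  exists (fun v => False_rect _ (V0 (inhabits v))) => M a.
  suff -> : assign a = assign (a \o (@ord0_elim V)
      \o (fun v => False_rect _ (V0 (inhabits v)))) by [].
  by apply: dep_funext => s; apply: dep_funext => -[v]; case: (V0 (inhabits v)).
have [[I F] FP] := formula_support phi.
pose strip (u : {s & vars s0 V s}) : V := match tagged u with var v => v end.
(* The extra index [None] makes the range of [c] nonempty, so that variables
   outside the support can be collapsed somewhere. *)
pose c (i : option I) := odflt v0 (omap strip (obind F i)).
pose r (v : V) := if pselect (exists i, c i = v) is left e then projT1 (cid e)
                  else None.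
exists #|{: option I}|, (c \o enum_val), (enum_rank \o r) => M a.
apply: FP => i s x Fi; case: x Fi => v Fi /=; rewrite enum_rankK /r.
case: pselect => [e|[]]; first by case: cid => j /= ->.
by exists (Some i); rewrite /c /=; move: Fi => /= ->.
Qed.

End FiniteSupport.

(** * Types of tuples and universal closures *)

Section TupleTypes.
Variables (S : signature) (M : structure S) (s0 : sorts S).

Lemma tp_complete V (a : V -> M s0) : complete_type (theory M) (tp a).
Proof.
split=> [n phi pphi|phi]; first by exists M, a; split.
by have [h|h] := pselect (sat phi (assign a)); [left|right].
Qed.

Lemma sat_map_vars V W (r : V -> W) (a : W -> M s0) phi :
  sat (rename (map_vars r) phi) (assign a) <-> sat phi (assign (a \o r)).
Proof.
rewrite sat_rename.
suff -> : (fun s x => assign a (map_vars r x)) = assign (a \o r) by [].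
by apply: dep_funext => s; apply: dep_funext => -[].
Qed.

Lemma tp_comp V W (r : V -> W) (a b : W -> M s0) :
  tp a = tp b -> tp (a \o r) = tp (b \o r).
Proof.
move=> ab; apply/seteqP; split=> phi /sat_map_vars.
  by rewrite -[sat _ _]/(tp a _) ab => /sat_map_vars.
by rewrite -[sat _ _]/(tp b _) -ab => /sat_map_vars.
Qed.

End TupleTypes.

Section Closure.
Variables (S : signature) (s0 : sorts S).

Fixpoint conjs X n : ('I_n -> formula (S := S) X) -> formula X :=
  match n with
  | 0 => fun=> Neg (Falsum X)
  | n.+1 => fun phi => Conj (phi ord0) (conjs (fun i => phi (lift ord0 i)))
  end.

Lemma sat_Conj (M : structure S) X (phi psi : formula X) (v : valuation M X) :
  sat (Conj phi psi) v <-> sat phi v /\ sat psi v.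
Proof.
split=> /= [h|[h1 h2] h]; last exact: h.
by split; apply: contrapT => n; apply: h.
Qed.

Lemma sat_conjs (M : structure S) X n (phi : 'I_n -> formula X)
    (v : valuation M X) :
  sat (conjs phi) v <-> forall i, sat (phi i) v.
Proof.
elim: n phi => [|n IH] phi; first by split=> // _ [].
rewrite [conjs _]/= sat_Conj IH; split=> [[h0 h] i|h]; last by [].
by case: (unliftP ord0 i) => [j ->|->].
Qed.

(** Prepending an entry to a tuple; this matches [head_renaming], under which
    variable [0] becomes the one bound by the quantifier. *)
Definition fcons T k (x : T) (a : 'I_k -> T) (i : 'I_k.+1) : T :=
  oapp a x (unlift ord0 i).

Lemma fcons0 T k (x : T) (a : 'I_k -> T) : fcons x a ord0 = x.
Proof. by rewrite /fcons unlift_none. Qed.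

Lemma fconsS T k (x : T) (a : 'I_k -> T) i : fcons x a (lift ord0 i) = a i.
Proof. by rewrite /fcons liftK. Qed.

Definition head_renaming k :
    renaming (vars s0 'I_k.+1) (extend (vars s0 'I_k) s0) :=
  fun s x => match x with
             | var i => match unlift ord0 i with
                        | Some j => Old s0 (var s0 j)
                        | None => Fresh _ s0
                        end
             end.

Definition all_head k (phi : formula (vars s0 'I_k.+1)) :
  formula (vars s0 'I_k) := All (rename (@head_renaming k) phi).

Lemma sat_all_head (M : structure S) k (phi : formula (vars s0 'I_k.+1))
    (a : 'I_k -> M s0) :
  sat (all_head phi) (assign a) <-> forall x, sat phi (assign (fcons x a)).
Proof.
rewrite /=; suff e x : sat (rename (@head_renaming k) phi) (push x (assign a)) <->
    sat phi (assign (fcons x a)) by split=> h x; apply/e.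
rewrite sat_rename.
suff -> : (fun s y => push x (assign a) (head_renaming y)) =
  assign (fcons x a) by [].
apply: dep_funext => s; apply: dep_funext => -[j] /=.
by rewrite /fcons; case: unlift.
Qed.

Fixpoint all_closure k : formula (vars s0 'I_k) -> sentence S :=
  match k with
  | 0 => rename (X := vars s0 'I_0)
      (fun s x => match x with var i => ord0_elim _ i end)
  | k.+1 => fun phi => all_closure (all_head phi)
  end.

Lemma theory_all_closure (M : structure S) k (phi : formula (vars s0 'I_k)) :
  theory M (all_closure phi) <-> forall a : 'I_k -> M s0, sat phi (assign a).
Proof.
elim: k phi => [|k IH] phi /=.
  rewrite /theory /= sat_rename; split=> h; last first.
    have := h (fun i => ord0_elim _ i).
    congr sat; apply: dep_funext => s.
    by apply: dep_funext => -[] [].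
  move=> a; move: h; congr sat; apply: dep_funext => s.
  by apply: dep_funext => -[] [].
rewrite IH; split=> [h a|h a]; last by apply/sat_all_head.
have /sat_all_head/(_ (a ord0)) := h (fun i => a (lift ord0 i)).
congr sat; congr assign; apply/funext => i; rewrite /fcons.
by case: (unliftP ord0 i) => [j ->|->].
Qed.

(** A finite part of a type is consistent with the theory of [N] by means of some
    other model, but the theory of [N] is complete: if [N] did not realize the
    conjunction, a universal closure of its negation would hold in [N], hence in
    that model. *)
Lemma consistent_realized (N : structure S) V (p : set (formula (vars s0 V))) n
    (phi : 'I_n -> formula (vars s0 V)) :
  consistent (theory N) p -> (forall i, p (phi i)) ->
  exists b : V -> N s0, forall i, sat (phi i) (assign b).
Proof.
move=> cp /cp[K [a [NK Ka]]].
have [k [c [r cr]]] := formula_retract (conjs phi).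
apply: contrapT => nb.
have /theory_all_closure/NK/theory_all_closure/(_ (a \o c)) :
    forall b : 'I_k -> N s0,
    sat (Neg (rename (map_vars r) (conjs phi))) (assign b).
  by move=> b /= /sat_map_vars/sat_conjs h; apply: nb; exists (b \o r).
by move=> h; apply: h; apply/sat_map_vars; apply: (cr K a).1; apply/sat_conjs.
Qed.

End Closure.

(** * Homogeneity of countable atomic structures *)

Section Homogeneity.
Variables (L : language) (M : structure (one_sorted L)).
Hypotheses (cM : countable [set: M tt]) (aM : atomic M).

(** The isolating formula of the longer tuple says, quantified existentially, that
    the shorter one can be extended; this existential statement belongs to the
    common type. *)
Lemma tp_extend k (a b : 'I_k -> M tt) x : tp a = tp b ->
  exists y, tp (fcons x a) = tp (fcons y b).
Proof.
move=> ab; have [theta theta_x isol] := aM (fcons x a).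
suff [y theta_y] : exists y, sat theta (assign (fcons y b)).
  by exists y; apply/esym/isol => //; exact: tp_complete.
apply: contrapT => ny.
suff : tp b (all_head (Neg theta)).
  rewrite -ab => h; have /sat_all_head/(_ x) := h : sat _ _.
  by apply.
apply: (sat_all_head _ _).2 => y theta_y; apply: ny; by exists y.
Qed.

(** The finite approximations of the back-and-forth construction. *)
Record partial_elementary := PartialElementary {
  pe_size : nat;
  pe_pair :> 'I_pe_size -> M tt * M tt;
  pe_tp : tp (fst \o pe_pair) = tp (snd \o pe_pair) }.

Definition pe_rel (P : partial_elementary) x y := exists i, P i = (x, y).

Definition pe_le (P Q : partial_elementary) :=
  forall x y, pe_rel P x y -> pe_rel Q x y.

Lemma pe_add (P : partial_elementary) x y
    (xy : tp (fcons x (fst \o P)) = tp (fcons y (snd \o P))) :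
  exists Q, pe_le P Q /\ pe_rel Q x y.
Proof.
have e T (f : M tt * M tt -> T) :
    f \o fcons (x, y) P = fcons (f (x, y)) (f \o P).
  by apply/funext => i; rewrite /= /fcons; case: unlift.
have tpQ : tp (fst \o fcons (x, y) P) =
           tp (snd \o fcons (x, y) P) by rewrite !e.
exists (PartialElementary tpQ); split=> [u v [i uv]|].
  by exists (lift ord0 i); rewrite /= fconsS.
by exists ord0; rewrite /= fcons0.
Qed.

Lemma pe_step (P : partial_elementary) (o : option (M tt)) :
  exists Q, pe_le P Q /\ forall x, o = Some x ->
    (exists y, pe_rel Q x y) /\ (exists z, pe_rel Q z x).
Proof.
case: o => [x|]; last by exists P; split.
have [y /pe_add[Q [PQ Qxy]]] := tp_extend x (pe_tp P).
have [z /esym/pe_add[Q' [QQ' Qzx]]] := tp_extend x (esym (pe_tp Q)).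
exists Q'; split=> [u v /PQ/QQ'//|_ [<-]].
by split; [exists y; exact: QQ'|exists z].
Qed.

(** Back-and-forth along an enumeration of [M].  The union of the chain is kept
    as a relation: that it is the graph of an automorphism follows from its being
    elementary on all finite families. *)
Lemma elementary_correspondence k (a b : 'I_k -> M tt) : tp a = tp b ->
  exists R : M tt -> M tt -> Prop,
  [/\ forall i, R (a i) (b i),
      forall x, exists y, R x y, forall x, exists z, R z x &
      forall (I : finType) (u v : I -> M tt), (forall i, R (u i) (v i)) ->
        tp u = tp v].
Proof.
move=> ab; have /countable_injP[f /in2TT finj] := cM.
(* A partial enumeration, as [M] may be finite or empty. *)
pose e n : option (M tt) := if pselect (exists x, f x = n) is left h
  then Some (projT1 (cid h)) else None.
have ef x : e (f x) = Some x.
  rewrite /e; case: pselect => [h|[]]; last by exists x.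
  by congr Some; apply: finj; case: cid.
have /choice[next nextP] :=
  fun nP : nat * partial_elementary => pe_step nP.2 (e nP.1).
have ab0 : tp (fst \o (fun i => (a i, b i))) =
  tp (snd \o (fun i => (a i, b i))) by [].
pose P := fix P n := if n is n.+1 then next (n, P n) else PartialElementary ab0.
have Ple m n : (m <= n)%N -> pe_le (P m) (P n).
  move=> /subnK <-; elim: (n - m)%N => [//|d IH] x y /IH.
  by rewrite addSn /=; exact: (nextP (_, _)).1.
exists (fun x y => exists n, pe_rel (P n) x y); split.
- by move=> i; exists 0%N, i.
- by move=> x; have [[y]] := (nextP (f x, P (f x))).2 x (ef x); exists y, (f x).+1.
- by move=> x; have [_ [z]] := (nextP (f x, P (f x))).2 x (ef x); exists z, (f x).+1.
move=> I u v /choice[n nP].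
have /choice[r rP] : forall i, exists j, P (\max_i n i)%N j = (u i, v i).
  by move=> i; apply: (Ple (n i)); first exact: (leq_bigmax i).
have -> : u = (fst \o P (\max_i n i)%N) \o r.
  by apply/funext => i /=; rewrite rP.
have -> : v = (snd \o P (\max_i n i)%N) \o r.
  by apply/funext => i /=; rewrite rP.
by apply: tp_comp; exact: pe_tp.
Qed.

(** All properties required of the automorphism express that suitable atomic
    formulas are preserved by the correspondence: equality of two variables for
    injectivity and single-valuedness, equations [f(x) = y] for the function
    symbols. *)
Lemma atomic_homogeneous k (a b : 'I_k -> M tt) : tp a = tp b ->
  exists g : automorphism M, forall i, g tt (a i) = b i.
Proof.
move=> /elementary_correspondence[R [Rab /choice[g gR] /choice[g' g'R] Rtp]].
pose V X := @Var (one_sorted L) (vars (S := one_sorted L) tt X) tt.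
have Rfun x y x' y' : R x y -> R x' y' -> x = x' <-> y = y'.
  move=> xy xy'.
  have e : tp (fun b : bool => if b then x else x') =
      tp (fun b => if b then y else y').
    by apply: Rtp => -[].
  pose phi := Equal (V bool (var _ true)) (V bool (var _ false)).
  rewrite -[x = x']/(tp (fun b : bool => if b then x else x') phi).
  by rewrite -[y = y']/(tp (fun b : bool => if b then y else y') phi) e.
have gK : cancel g g' by move=> x; apply/(Rfun _ _ _ _ (g'R _) (gR _)).
have g'K : cancel g' g by move=> x; apply/(Rfun _ _ _ _ (gR _) (g'R _)).
have gtp (I : finType) (u : I -> M tt) : tp u = tp (g \o u).
  by apply: Rtp => i; exact: gR.
have gf (f : lfsym L) (u : 'I_(lfar f) -> M tt) :
    g (@fint (one_sorted L) M f u) = @fint (one_sorted L) M f (g \o u).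
  apply/esym.
  pose phi := Equal (@App (one_sorted L) _ f (fun i => V _ (var _ (Some i))))
    (V _ (var _ None)).
  pose w := oapp u (@fint (one_sorted L) M f u).
  have : tp w phi by [].
  by rewrite gtp.
have gr (r : lrsym L) (u : 'I_(lrar r) -> M tt) :
    @rint (one_sorted L) M r (g \o u) <-> @rint (one_sorted L) M r u.
  pose phi := @Rel (one_sorted L) _ r (fun i => V _ (var _ i)).
  suff : tp (g \o u) phi <-> tp u phi by [].
  by rewrite -gtp.
pose on_sorts (h : M tt -> M tt) s : M s -> M s :=
  match s with tt => h end.
unshelve eexists (@Automorphism _ M (on_sorts g) (on_sorts g') _ _ _ _).
- by case.
- by case.
- exact: gf.
- exact: gr.
by move=> i /=; apply/(Rfun _ _ _ _ (gR _) (Rab i)).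
Qed.

End Homogeneity.

(** * The base structure inside its expansion *)

Section Relativization.
Variables (L : language) (E : extension L).
Variables (M : structure (one_sorted L)) (N : structure (expanded E)).
Variable iota : M tt -> N None.
Hypothesis emb : embedding iota.

Definition embed_at s : M s -> N None := match s with tt => iota end.

Lemma home_term_eval X Y (rho : @home_renaming L E X Y) (v : valuation N Y)
    (d : valuation M X) s (t : @term (one_sorted L) X s) :
  (forall s x, v None (rho s x) = embed_at (d s x)) ->
  term_eval v (home_term rho t) = embed_at (term_eval d t).
Proof.
move=> vd; elim: t => [{}s x|f a IH]; first exact: vd.
apply: etrans (esym (embedding_fint emb (fun i => term_eval d (a i)))).
by apply: (congr1 (@fint (expanded E) N (inl f))); apply: dep_funext => i; exact: IH.
Qed.

(** Quantifiers relativized to [iota M] range over a copy of [M], so relativized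
    formulas speak about [M]. *)
Lemma sat_relativize U : defines_range iota U ->
  forall X (phi : @formula (one_sorted L) X) Y (rho : @home_renaming L E X Y)
    (v : valuation N Y) (d : valuation M X),
  (forall s x, v None (rho s x) = embed_at (d s x)) ->
  sat (relativize U rho phi) v <-> sat phi d.
Proof.
move=> UR X phi; elim: phi => {X} [X|X s t u|X r a|X phi IH psi JH|X s phi IH]
  Y rho v d vd.
- by [].
- rewrite /= !(home_term_eval _ vd).
  by case: s t u => t u; split=> [/(embedding_inj emb)|->].
- rewrite -[sat _ d]/(rint _) -(embedding_rint emb (fun i => term_eval d (a i))).
  rewrite /=; suff -> : (fun i => term_eval v (home_term rho (a i))) =
    iota \o (fun i => term_eval d (a i)) by [].
  by apply: dep_funext => i; exact: home_term_eval.
- by rewrite /= (IH _ _ _ _ vd) (JH _ _ _ _ vd).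
- have e (c : N None) (x : M s) : c = embed_at x ->
      sat (relativize U (@home_lift L E X Y rho s) phi) (push c v) <->
      sat phi (push x d).
    by move=> cx; apply: IH => s' -[|{}s' y] /=.
  have Uc (c : N None) : sat (rename (@fresh_renaming L E Y) U) (push c v) <->
      range iota c.
    rewrite -UR sat_rename.
    suff -> : (fun s x => push c v (fresh_renaming Y x)) = assign (fun=> c) by [].
    by apply: dep_funext => s'; apply: dep_funext => -[].
  case: s phi IH e => phi _ e; split=> h x.
    by apply/(e (iota x)) => //; apply: h; apply/Uc; exists x.
  by move=> /Uc[y _ yx]; apply/(e x y); [rewrite -yx|exact: h].
Qed.

End Relativization.

Section Translates.
Variables (L : language) (E : extension L).
Variables (M : structure (one_sorted L)) (N : structure (expanded E)).
Variable iota : M tt -> N None.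
Hypothesis exp : expansion iota.
Let emb : embedding iota := expansion_embedding exp.
Local Notation H := (aut_expansion iota).
Local Notation X := (coset_space H).
Local Notation nform := (hformula E (M tt)).

(** [iota M] is invariant under [Aut N], and its [L]-structure is part of that of
    [N]; hence automorphisms of [N] restrict to automorphisms of [M]. *)
Lemma aut_restrict (h : automorphism N) :
  exists g : automorphism M, forall a, h None (iota a) = iota (g tt a).
Proof.
have iota_inj := embedding_inj emb.
have /choice[g hg] : forall a, exists b, h None (iota a) = iota b.
  move=> a; have : range iota (h None (iota a)).
    by rewrite -(expansion_invariant exp h); exists (iota a) => //; exists a.
  by move=> [b _ <-]; exists b.
have /choice[g' hg'] : forall b, exists a, h None (iota a) = iota b.
  move=> b; have : [set h None y | y in range iota] (iota b).
    by rewrite (expansion_invariant exp h); exists b.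
  by move=> [_ [a _ <-] hab]; exists a.
have g'K : cancel g' g by move=> b; apply: iota_inj; rewrite -hg hg'.
have gK : cancel g g'.
  move=> a; apply: iota_inj; apply: (can_inj (aut_funK h (s := None))).
  by rewrite hg' hg.
have gf (f : lfsym L) (u : 'I_(lfar f) -> M tt) :
    g (@fint (one_sorted L) M f u) = @fint (one_sorted L) M f (g \o u).
  apply: iota_inj; rewrite -hg !(embedding_fint emb) /=.
  apply: etrans (@aut_fint _ N h (inl f) (fun i => iota (u i))) _.
  apply: (congr1 (@fint (expanded E) N (inl f))).
  apply: dep_funext => i /=; exact: hg.
have gr (r : lrsym L) (u : 'I_(lrar r) -> M tt) :
    @rint (one_sorted L) M r (g \o u) <-> @rint (one_sorted L) M r u.
  rewrite -!(embedding_rint emb) /=.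
  apply: iff_trans (@aut_rint _ N h (inl (inl r)) (fun i => iota (u i))).
  suff -> : iota \o (g \o u) = (fun i => h None (iota (u i))) by [].
  by apply/funext => i /=; rewrite hg.
pose on_sorts (k : M tt -> M tt) s : M s -> M s :=
  match s with tt => k end.
unshelve eexists (@Automorphism _ M (on_sorts g) (on_sorts g') _ _ _ _).
- by case.
- by case.
- exact: gf.
- exact: gr.
exact: hg.
Qed.

Lemma aut_expansion_invg k : H k -> H k^-1%g.
Proof.
move=> [h hk]; exists (autV h) => a; apply: (can_inj (aut_funK h (s := None))).
rewrite [aut_fun (autV h) _]/= aut_invK hk; congr iota.
exact: esym (aut_invK k _).
Qed.

Lemma aut_expansion_mulg k l : H k -> H l -> H (k * l)%g.
Proof.
move=> [h hk] [i il]; exists (autM h i) => a.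
by rewrite -[autM h i _ _]/(h None (i None (iota a))) il hk.
Qed.

Lemma lcoset_mulr g k : H k -> lcoset H (g * k)%g = lcoset H g.
Proof.
move=> Hk; apply: coset_space_eq; apply/seteqP; split=> _ [l Hl <-] /=.
  by exists (k * l)%g; [exact: aut_expansion_mulg|rewrite mulgA].
exists (k^-1 * l)%g; last by rewrite mulgA mulgK.
by apply: aut_expansion_mulg => //; exact: aut_expansion_invg.
Qed.

Lemma cosetE (C : X) : exists g, C = lcoset H g.
Proof. by case: (coset_setP C) => g Cg; exists g; exact: coset_space_eq. Qed.

(** The point of [Exp] attached to [g] is the type of this family in [N]. *)
Definition translated (g : automorphism M) (a : M tt) : N None := iota (g^-1%g tt a).

Definition realizes (phi : nform) (C : X) :=
  exists2 g, coset_set C g & sat phi (assign (translated g)).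

(** Replacing [g] by [g * k] with [k] in [H] moves the family by an automorphism
    of [N], so the choice of the representative does not matter. *)
Lemma realizes_lcoset phi g :
  realizes phi (lcoset H g) <-> sat phi (assign (translated g)).
Proof.
split=> [[_ [k Hk <-]]|phig]; last first.
  exists g => //; exists 1%g; last by rewrite mulg1.
  by exists (aut1 N).
have /aut_expansion_invg[h hk] := Hk; move=> phik; apply/(sat_aut h).
move: phik; congr sat; apply: dep_funext => s; apply: dep_funext => -[a] /=.
by rewrite hk /translated invgM.
Qed.


End Translates.

Arguments realizes_lcoset {L E M N iota} phi g.

(** * Density, continuity and definability *)

(** Total boundedness of balls, in the form of a finite labelling. *)
Definition bounded_sets_subdivide (K : numFieldType) :=
  forall B d : K, 0 < d -> exists n (cell : K -> 'I_n), forall z w,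
    `|z| <= B -> `|w| <= B -> cell z = cell w -> `|z - w| < d.

(** Completeness, stated with the norm rather than with the uniform structure: the
    construction of limits takes place over an abstract [numFieldType], and only
    these two properties of the complex numbers enter. *)
Definition cauchy_filters_converge (K : numFieldType) :=
  forall F : set_system K, ProperFilter F ->
  (forall e : K, 0 < e -> exists z, F [set w | `|z - w| < e]) ->
  exists l, forall e : K, 0 < e -> F [set w | `|l - w| < e].

Section Expansions.
Variables (L : language) (E : extension L).
Variables (M : structure (one_sorted L)) (N : structure (expanded E)).
Variable iota : M tt -> N None.
Hypotheses (cM : countable [set: M tt]) (aM : atomic M).
Hypotheses (exp : expansion iota) (fN : full N).
Let emb : embedding iota := expansion_embedding exp.
Local Notation H := (aut_expansion iota).
Local Notation X := (coset_space H).
Local Notation nform := (hformula E (M tt)).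
Local Notation Ntypes := (@types (expanded E) (theory N) None (M tt)).

Lemma range_aut (h : automorphism N) b : range iota (h None b) <-> range iota b.
Proof.
have := expansion_invariant exp h => hR; split=> rb; last by rewrite -hR; exists b.
move: rb; rewrite -{1}hR => -[c rc] /(can_inj (aut_funK h (s := None))) <-.
exact: rc.
Qed.

Lemma range_definable : exists U, defines_range iota U.
Proof.
have [|phi phiP] := fN (D := [set a : 'I_1 -> N None | range iota (a ord0)]).
  by move=> h a; exact: range_aut.
exists (rename (map_vars (fun=> tt)) phi) => b.
rewrite /hsat sat_map_vars.
by rewrite -[sat _ _]/([set a | sat phi (assign a)] (fun=> b)) -phiP.
Qed.

(** In [M] the formula says that [v] is equal to something, which is trivially
    true; relativized, it says that [v] lies in [iota M].  Membership of the
    variables in [iota M] thus belongs to the restriction of any type in [Exp]. *)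
Definition existing (V : Type) (v : V) : lformula L V :=
  Neg (@All (one_sorted L) _ tt (Neg (@Equal (one_sorted L) _ tt
    (Var (@Fresh (one_sorted L) _ tt))
    (Var (@Old (one_sorted L) _ tt tt (var (S := one_sorted L) tt v)))))).

Lemma sat_relativize_existing U : defines_range iota U ->
  forall V (v : V) (b : V -> N None),
  sat (relativize U (@home_vars L E V) (existing v)) (assign b) -> range iota (b v).
Proof.
move=> UR V v b /= h; apply: contrapT => nv; apply: h => c Uc cv; apply: nv.
move: Uc; rewrite sat_rename cv.
have -> : (fun s x => push (b v) (assign b) (fresh_renaming (E := E)
    (vars (S := expanded E) None V) x)) = assign (fun=> b v).
  by apply: dep_funext => s'; apply: dep_funext => -[].
by move/UR.
Qed.

(** The family of formulas handed to [N] says that [phi] holds, that the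
    variables [c] of [phi] lie in [iota M], and that they satisfy there the
    formula isolating the type of [c] in [M].  A realization is the image of a
    tuple [d] with the same type as [c], and homogeneity yields [g] with
    [g d = c]. *)
Lemma Exp_realized (p : Ntypes) phi : Exp iota p -> (p : set nform) phi ->
  exists g, sat phi (assign (translated iota g)).
Proof.
move=> [U UR pM] pphi.
have [k [c [r cr]]] := formula_retract phi.
have [theta theta_c isol] := aM c.
have pL psi : sat psi (assign (@id (M tt))) ->
    (p : set nform) (relativize U (@home_vars L E (M tt)) psi).
  by move=> psiM; have : tp (@id (M tt)) psi by []; rewrite -pM.
pose form (i : 'I_(k + 2)) := match fintype.split i with
  | inl i => relativize U (@home_vars L E (M tt)) (existing (c i))
  | inr i => if i == ord0 then phi else
      relativize U (@home_vars L E (M tt)) (rename (map_vars c) theta)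
  end.
have [|b bform] := consistent_realized (phi := form) (type_setP p).1.
  move=> i; rewrite /form; case: fintype.split => j.
    by apply: pL => /= h; apply: (h (c j)).
  by case: ifP => // _; apply: pL; apply/sat_map_vars.
have /choice[d db] : forall i, exists x, iota x = b (c i).
  move=> i; have := bform (lshift 2 i); rewrite /form (unsplitK (inl i)).
  by move=> h; have [x _ xb] := sat_relativize_existing UR h; exists x.
have tp_dc : tp d = tp c.
  apply: isol; first exact: tp_complete.
  have := bform (rshift k ord_max); rewrite /form (unsplitK (inr ord_max)) /=.
  rewrite relativize_rename; apply: (sat_relativize emb UR _ _).1.
  by move=> s -[j] /=; rewrite db.
have [g gd] := atomic_homogeneous cM aM tp_dc.
exists g; apply/cr.
have := bform (rshift k ord0); rewrite /form (unsplitK (inr ord0)) /=.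
rewrite cr; congr sat; congr assign; apply/funext => x /=.
by rewrite -db /translated -gd; congr iota; exact: esym (aut_funK g _).
Qed.

Definition fixes k (c : 'I_k -> M tt) : set (automorphism M) :=
  [set v | forall i, v tt (c i) = c i].

(** Pointwise stabilizers of finite tuples form a base of neighbourhoods of [1]. *)
Lemma entourage_fixes (F : set (X * X)) : entourage F <->
  exists k (c : 'I_k -> M tt), forall v C, fixes c v -> F (C, translate v C).
Proof.
split=> [/coset_entourageE[V [oV V1 _ VF]]|[k [c cF]]].
  have [k [a aV]] := oV _ V1.
  pose home (u : {s & M s}) : M tt := match u with existT s x =>
    match s as s return M s -> M tt with tt => id end x end.
  exists k, (fun i => home (a i)) => v C vfix; apply/VF/aV => i /=.
  by have := vfix i; case: (a i) => -[] x /=.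
apply/coset_entourageE; exists (fixes c); split=> [||v vc i|] //.
- move=> v vc; exists k, (fun i => Tagged M (c i)) => w wv i.
  by rewrite -[RHS](vc i); exact: esym (wv i).
- by rewrite -{1}(vc i); exact: (aut_funK v).
Qed.

(** If [v] fixes the variables [c] of [phi], then [(v * g)^-1 c = g^-1 c]. *)
Lemma realizes_fixes phi : exists k (c : 'I_k -> M tt),
  forall v (C : X), fixes c v ->
  realizes phi (translate v C) <-> realizes phi C.
Proof.
have [k [c [r cr]]] := formula_retract phi.
exists k, c => v C vc; have [g ->] := cosetE C.
rewrite translate_lcoset !realizes_lcoset cr [X in _ <-> X]cr.
suff -> : translated iota (v * g)%g \o c = translated iota g \o c by [].
apply/funext => i /=; rewrite /translated invgM; congr (iota (g^-1%g tt _)).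
by rewrite -{1}(vc i); exact: (aut_funK v).
Qed.

(** A coset [gH] in [A] is remembered through the tuple [iota (g^-1 c)] only.  This
    loses nothing: if [g^-1 c = g'^-1 c] then [g = v * g'] with [v = g * g'^-1]
    fixing [c].  The set of these tuples is invariant under [Aut N] because
    automorphisms of [N] restrict to elements of [H], which act on representatives
    from the right. *)
Lemma saturated_definable k (c : 'I_k -> M tt) (A : set X) :
  (forall v C, fixes c v -> A C -> A (translate v C)) ->
  exists phi, forall C, realizes phi C <-> A C.
Proof.
move=> Asat.
pose D := [set d | exists2 g, A (lcoset H g) & d = translated iota g \o c].
have Dinv (h : automorphism N) a : D a -> D (fun i => h None (a i)).
  move=> [g Ag ->]; have [l hl] := aut_restrict exp h.
  exists (g * l^-1)%g; last first.
    by apply/funext => i /=; rewrite /translated invgM invgK hl.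
  rewrite lcoset_mulr//; apply: (aut_expansion_invg).
  by exists h.
have [|phi phiD] := fN (D := D).
  move=> h a; split=> [/(Dinv (autV h))|]; last exact: Dinv.
  rewrite (_ : (fun i => _) = a)//.
  by apply/funext => i; exact: aut_funK.
exists (rename (map_vars c) phi) => C; have [g ->] := cosetE C.
rewrite realizes_lcoset sat_map_vars.
rewrite -[sat _ _]/([set a | sat phi (assign a)] _) -phiD.
split=> [[g' Ag' gg']|Ag]; last by exists g.
(* [g * g'^-1] fixes [c], so saturation carries [g'H] to [gH]. *)
have -> : g = (g * g'^-1 * g')%g by rewrite -mulgA mulVg mulg1.
rewrite -translate_lcoset; apply: Asat => // i.
have /(embedding_inj emb) e := congr1 (fun f => f i) gg'.
by apply: etrans (congr1 (g tt) (esym e)) _; exact: (aut_invK g).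
Qed.

Lemma complete_type_conjs (p : Ntypes) n (phi : 'I_n -> nform) :
  (forall i, (p : set nform) (phi i)) -> (p : set nform) (conjs phi).
Proof.
elim: n phi => [|n IH] phi pphi /=.
  apply/(complete_type_Neg _ (type_setP p)) => pF.
  by have [|K [a [_ /(_ ord0)]]] := (type_setP p).1 1%N (fun=> Falsum _).
apply/(complete_type_Conj _ _ (type_setP p)); split; first exact: pphi.
by apply: IH => i; exact: pphi.
Qed.

(** On a stabilizer orbit [f] varies little, so the saturation of the preimage of
    a small cell still has small oscillation.  The saturated preimages are
    definable and finite in number, and cover [X]; by density their defining
    formulas cannot all be rejected by [p]. *)
Lemma small_oscillation (K : numFieldType) (f : buc K X) (p : Ntypes) (e : K) :
  bounded_sets_subdivide K -> Exp iota p -> 0 < e ->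
  exists2 phi, (p : set nform) phi &
    forall C D, realizes phi C -> realizes phi D -> `|f C - f D| < e.
Proof.
move=> cells pE e0; have e3 : 0 < e / 3%:R by rewrite divr_gt0.
case: f => f /= /asboolP[[B fB] /unif_continuousE/(_ _ e3)].
move=> /entourage_fixes[k [c cf]].
have [n [cell cellP]] := cells B _ e3.
have /choice[phi phiP] : forall t, exists phi, forall C, realizes phi C <->
    exists2 D, cell (f D) = t & exists2 v, fixes c v & C = translate v D.
  move=> t; apply: (saturated_definable (c := c)) => v _ vc [D Dt [w wc ->]].
  exists D => //; exists (v * w)%g; last by rewrite translateM.
  by move=> i; apply: etrans (congr1 (v tt) (wc i)) _; exact: vc.
have [t pt] : exists t, (p : set nform) (phi t).
  apply: contrapT => np.
  have /complete_type_conjs/(Exp_realized pE)[g] :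
      forall t, (p : set nform) (Neg (phi t)).
    move=> t; apply/(complete_type_Neg _ (type_setP p)) => pt.
    by apply: np; exists t.
  move=> /sat_conjs/(_ (cell (f (lcoset H g)))) h; apply: h.
  apply/realizes_lcoset/phiP; exists (lcoset H g) => //.
  by exists 1%g; rewrite ?translate1.
exists (phi t) => // C D /phiP[C' C't [v vc ->]] /phiP[D' D't [w wc ->]].
have fv := cf v C' vc; have fw := cf w D' wc.
have fC'D' := cellP _ _ (fB C') (fB D') (etrans C't (esym D't)).
have -> : e = e / 3%:R + (e / 3%:R + e / 3%:R).
  by rewrite -mulr2n -mulrS -[RHS]mulr_natr divfK ?pnatr_eq0.
rewrite (le_lt_trans (ler_distD (f C') _ _))// ltrD//; first by rewrite distrC.
by rewrite (le_lt_trans (ler_distD (f D') _ _))// ltrD.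
Qed.

End Expansions.

(** * Complex scalars *)

Section ComplexScalars.
Variable R : realType.

Lemma normc_ge_Im (z : R[i]) : `|complex.Im z|%:C <= `|z|.
Proof.
by case: z => a b; rewrite normc_def lecR -sqrtr_sqr ler_wsqrtr // lerDr sqr_ge0.
Qed.

Lemma normc_le_ReIm (z : R[i]) : `|z| <= (`|complex.Re z| + `|complex.Im z|)%:C.
Proof.
rewrite normc_def lecR -[leRHS]ger0_norm ?addr_ge0// -sqrtr_sqr ler_wsqrtr//.
rewrite sqrrD !real_normK ?num_real// lerD2r lerDl mulrn_wge0 // mulr_ge0//.
Qed.

Lemma gt0_complexE (e : R[i]) : 0 < e -> e = (complex.Re e)%:C /\ 0 < complex.Re e.
Proof. by case: e => a b; rewrite ltcE /= => /andP[/eqP-> a0]. Qed.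

Lemma normc_lt_ReIm (z : R[i]) (e : R) :
  `|complex.Re z| < e / 2 -> `|complex.Im z| < e / 2 -> `|z| < e%:C.
Proof.
move=> re im; apply: le_lt_trans (normc_le_ReIm z) _.
by rewrite ltcR [e]splitr ltrD.
Qed.

(** Label [x] by the index of the interval of length [e], counted from [- B],
    that contains it. *)
Lemma real_bounded_sets_subdivide : bounded_sets_subdivide R.
Proof.
move=> B e e0; pose q x := Num.truncn ((x + B) / e).
exists (q B).+1, (fun x => inord (q x)) => x y xB yB.
have qP z : `|z| <= B -> (q z)%:R <= (z + B) / e < (q z).+1%:R /\ (q z < (q B).+1)%N.
  rewrite ler_norml => /andP[Bz zB].
  have z0 : 0 <= z + B by rewrite -lerBlDr sub0r.
  split; first by apply: truncn_itv; rewrite divr_ge0// ltW.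
  by rewrite ltnS le_truncn// ler_pM2r ?invr_gt0// lerD2r.
have [/andP[x1 x2] xq] := qP x xB; have [/andP[y1 y2] yq] := qP y yB.
move=> /(congr1 val); rewrite /= !inordK// => xy.
have -> : x - y = ((x + B) / e - (y + B) / e) * e.
  by rewrite -mulrBl divfK ?gt_eqF// opprD addrACA subrr addr0.
rewrite normrM (gtr0_norm e0) -[ltRHS]mul1r ltr_pM2r// ltr_norml.
rewrite -xy in y1 y2; move: x2 y2; rewrite -natr1 => x2 y2.
by rewrite ltrBrDl ltrBlDl; apply/andP; split; lra.
Qed.

Lemma complex_bounded_sets_subdivide : bounded_sets_subdivide R[i].
Proof.
move=> B e /gt0_complexE[-> e0]; have e2 : 0 < complex.Re e / 2 by rewrite divr_gt0.
have [n [cell cellP]] := real_bounded_sets_subdivide (complex.Re B) e2.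
exists #|{: 'I_n * 'I_n}|,
  (fun z => enum_rank (cell (complex.Re z), cell (complex.Im z))) => z w zB wB.
move=> /enum_rank_inj[re im].
have reB u : `|u| <= B -> `|complex.Re u| <= complex.Re B.
  by move=> uB; have := le_trans (normc_ge_Re u) uB; rewrite lecE => /andP[].
have imB u : `|u| <= B -> `|complex.Im u| <= complex.Re B.
  by move=> uB; have := le_trans (normc_ge_Im u) uB; rewrite lecE => /andP[].
apply: normc_lt_ReIm; rewrite raddfB /=; apply: cellP => //.
all: by [apply: reB|apply: imB].
Qed.

(** Real and imaginary parts are 1-Lipschitz and additive, so both push the filter
    forward to a Cauchy filter of real numbers. *)
Lemma complex_cauchy_filters_converge : cauchy_filters_converge R[i].
Proof.
move=> F FF Fc.
have part_cvg (part : R[i] -> R) : {morph part : z w / z - w} ->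
    (forall z, `|part z|%:C <= `|z|) ->
    exists x, forall e : R, 0 < e -> F [set w | `|x - part w| < e].
  move=> partB part_le.
  suff /cvg_ex[x /cvgrPdist_lt xP] : cvg (part @ F) by exists x.
  apply/cauchy_cvgP/cauchy_exP => e e0.
  have [|z Fz] := Fc e%:C; first by rewrite ltcR.
  exists (part z); apply: (filterS (P := [set w | `|z - w| < e%:C])) Fz => w /= zw.
  by rewrite -ball_normE /= -partB -ltcR (le_lt_trans (part_le _)).
have [x xP] := part_cvg (@complex.Re R) (raddfB _) (@normc_ge_Re R).
have [y yP] := part_cvg (@complex.Im R) (raddfB _) normc_ge_Im.
exists (x +i* y) => e' /gt0_complexE[-> e0].
have e2 : 0 < complex.Re e' / 2 by rewrite divr_gt0.
apply: filterS (filterI (xP _ e2) (yP _ e2)) => w /= [re im].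
by apply: normc_lt_ReIm; rewrite raddfB.
Qed.

End ComplexScalars.

(** * Characters and types *)

Section Correspondence.
Variables (L : language) (E : extension L).
Variables (M : structure (one_sorted L)) (N : structure (expanded E)).
Variable iota : M tt -> N None.
Hypotheses (cM : countable [set: M tt]) (aM : atomic M).
Hypotheses (exp : expansion iota) (fN : full N).
Variable K : numFieldType.
Hypothesis Kcells : bounded_sets_subdivide K.
Hypothesis Kcomplete : cauchy_filters_converge K.
Let emb : embedding iota := expansion_embedding exp.
Local Notation H := (aut_expansion iota).
Local Notation X := (coset_space H).
Local Notation nform := (hformula E (M tt)).
Local Notation Ntypes := (@types (expanded E) (theory N) None (M tt)).

Lemma realizes_Neg phi (C : X) :
  realizes (iota := iota) (Neg phi) C <-> ~ realizes phi C.
Proof. by have [g ->] := cosetE C; rewrite !realizes_lcoset. Qed.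

Lemma realizes_Conj phi psi (C : X) :
  realizes (iota := iota) (Conj phi psi) C <-> realizes phi C /\ realizes psi C.
Proof. by have [g ->] := cosetE C; rewrite !realizes_lcoset sat_Conj. Qed.

Lemma indicator_subproof (phi : nform) :
  (fun C : X => if `[< realizes phi C >] then 1 else 0 : K^o) \in @bdd_ucont K X.
Proof.
apply/asboolP; split.
  by exists 1 => C; case: ifP => _; rewrite ?normr1 ?normr0.
apply/unif_continuousE => e e0; have [k [c cP]] := realizes_fixes iota phi.
apply/entourage_fixes; exists k, c => v C vc /=; have vC := cP v C vc.
by rewrite (asbool_equiv_eq vC) subrr normr0.
Qed.

Definition indicator phi : buc K X := Buc (indicator_subproof phi).

Lemma indicatorE phi C : indicator phi C = if `[< realizes phi C >] then 1 else 0.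
Proof. by []. Qed.

Lemma indicator_Neg phi : indicator (Neg phi) = 1 - indicator phi.
Proof.
apply: val_inj; apply/funext => C.
rewrite -[RHS]/(1 - indicator phi C) -[LHS]/(indicator _ C) !indicatorE.
rewrite (asbool_equiv_eq (realizes_Neg phi C)).
by rewrite asbool_neg; case: asboolP => _; rewrite ?subrr ?subr0.
Qed.

Lemma indicator_Conj phi psi :
  indicator (Conj phi psi) = indicator phi * indicator psi.
Proof.
apply: val_inj; apply/funext => C.
rewrite -[RHS]/(indicator phi C * indicator psi C).
rewrite -[LHS]/(indicator _ C) !indicatorE.
rewrite (asbool_equiv_eq (realizes_Conj phi psi C)) asbool_and.
by case: asboolP => _; case: asboolP => _; rewrite ?mulr1 ?mulr0.
Qed.

Lemma indicator1 phi : (forall C : X, realizes phi C) -> indicator phi = 1.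
Proof.
move=> all_phi; apply: val_inj; apply/funext => C.
by rewrite [LHS]indicatorE asboolT.
Qed.

Lemma indicator0 phi : (forall C : X, ~ realizes phi C) -> indicator phi = 0.
Proof.
move=> no_phi; apply: val_inj; apply/funext => C.
by rewrite [LHS]indicatorE asboolF.
Qed.

(** The trace on [G/H] of the neighbourhood filter of [p]. *)
Definition type_filter (p : Ntypes) : set_system X :=
  [set A | exists2 phi, (p : set nform) phi & [set C | realizes phi C] `<=` A].

Lemma type_filter_proper p : Exp iota p -> ProperFilter (type_filter p).
Proof.
move=> pE; split; last split.
- move=> [phi /(Exp_realized cM aM exp pE)[g phig] /(_ (lcoset H g))].
  by apply; apply/realizes_lcoset.
- exists (conjs (@ord0_elim nform)); last by [].
  apply: complete_type_conjs => -[]; by [].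
- move=> A B [phi pphi phiA] [psi ppsi psiB].
  exists (Conj phi psi); first exact/(complete_type_Conj _ _ (type_setP p)).
  by move=> C /realizes_Conj[/phiA ? /psiB].
- by move=> A B AB [phi pphi phiA]; exists phi => // C /phiA/AB.
Qed.

(** The bijection of the theorem, as a relation: [chi] is evaluation at [p] of the
    continuous extension of functions on [G/H]. *)
Definition corresponds (chi : samuel K X) (p : Ntypes) :=
  forall f : buc K X, (f : X -> K^o) @ type_filter p --> (chi f : K^o).

(** By [small_oscillation] the image filter is Cauchy. *)
Lemma type_limit (p : Ntypes) (f : buc K X) : Exp iota p ->
  exists l : K, (f : X -> K^o) @ type_filter p --> (l : K^o).
Proof.
move=> pE; have pF := type_filter_proper pE.
have [|l lP] := Kcomplete (F := (f : X -> K) @ type_filter p).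
  move=> e e0.
  have [phi pphi osc] := small_oscillation cM aM exp fN f Kcells pE e0.
  have [g phig] := Exp_realized cM aM exp pE pphi.
  exists (f (lcoset H g)), phi => // C phiC.
  by apply: osc => //; exact/realizes_lcoset.
by exists l; apply/cvgrPdist_lt => e e0; exact: lP.
Qed.

Lemma type_morphism (p : Ntypes) : Exp iota p -> exists chi, corresponds chi p.
Proof.
move=> pE; have pF := type_filter_proper pE.
have /choice[chi chiP] := fun f => type_limit f pE.
have uniq (f : buc K X) (l : K) :
    (f : X -> K^o) @ type_filter p --> (l : K^o) -> chi f = l.
  by move=> fl; apply: (cvg_unique _ (chiP f) fl).
have chiB : {morph chi : f g / f - g}.
  by move=> f g; apply: uniq; exact: (cvgB (chiP f) (chiP g)).
have chiM : GRing.monoid_morphism chi.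
  split=> [|f g]; first by apply: uniq; exact: cvg_cst.
  by apply: uniq; exact: (cvgM (chiP f) (chiP g)).
have chiZ : scalable_for *%R chi.
  by move=> a f; apply: uniq; exact: (cvgM (cvg_cst a) (chiP f)).
pose mB := GRing.isZmodMorphism.Build _ _ chi chiB.
pose mM := GRing.isMonoidMorphism.Build _ _ chi chiM.
pose mZ := GRing.isScalable.Build _ _ _ _ chi chiZ.
exists (HB.pack_for {lrmorphism buc K X -> K | *%R} chi mB mM mZ) => f.
exact: chiP.
Qed.

Section MorphismType.
Variable chi : {lrmorphism buc K X -> K | *%R}.

Lemma morphism_Neg phi : chi (indicator (Neg phi)) = 1 - chi (indicator phi).
Proof. by rewrite indicator_Neg rmorphB rmorph1. Qed.

(** Indicators are idempotent, and characters take values in a field. *)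
Lemma indicator01 phi : chi (indicator phi) = 1 \/ chi (indicator phi) = 0.
Proof.
have : chi (indicator phi) * chi (indicator (Neg phi)) = 0.
  rewrite -rmorphM indicator_Neg -(rmorph0 chi); congr (chi _).
  apply: val_inj; apply/funext => C.
  rewrite -[LHS]/(indicator phi C * (1 - indicator phi C)) indicatorE.
  by case: asboolP => _; rewrite ?subrr ?mulr0 ?mul0r.
move=> /eqP; rewrite mulf_eq0 morphism_Neg subr_eq0.
by move=> /orP[/eqP|/eqP]; [right|left].
Qed.

(** Consistency: a finite conjunction whose indicator has value [1] is realized by
    some coset, as otherwise the indicator would be [0]; then [N] itself, with
    the family attached to the coset, is a witness. *)
Lemma morphism_complete_type :
  complete_type (theory N) [set phi | chi (indicator phi) = 1].
Proof.
split=> [n phi phi1|phi]; last first.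
  have [h|h] := indicator01 phi; [by left|right].
  by rewrite /= morphism_Neg h subr0.
have conj1 : chi (indicator (conjs phi)) = 1.
  elim: n phi phi1 => [|n IH] phi phi1 /=.
    rewrite indicator1 ?rmorph1// => C; apply/realizes_Neg => -[g _].
    by [].
  by rewrite indicator_Conj rmorphM /= phi1 IH ?mulr1.
have [C] : exists C : X, realizes (conjs phi) C.
  apply: contrapT => no; move: conj1; rewrite indicator0 ?rmorph0.
    by move=> /eqP; rewrite eq_sym oner_eq0.
  by move=> C phiC; apply: no; exists C.
have [g ->] := cosetE C; move=> /realizes_lcoset/sat_conjs phig.
by exists N, (translated iota g); split.
Qed.

Definition morphism_type : Ntypes := Types morphism_complete_type.

Lemma realizes_relativize U psi (C : X) : defines_range iota U ->
  realizes (relativize U (@home_vars L E (M tt)) psi) C <->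
  sat psi (assign (@id (M tt))).
Proof.
move=> UR; have [g ->] := cosetE C; rewrite realizes_lcoset.
apply: iff_trans (sat_aut g^-1%g psi (assign (@id (M tt)))).
by apply: (sat_relativize emb UR) => s -[a].
Qed.

(** A relativized formula has the same truth value at every coset, because its
    truth in [M] is invariant under [G]. *)
Lemma morphism_type_Exp : Exp iota morphism_type.
Proof.
have [U UR] := range_definable exp fN; exists U => //.
apply/seteqP; split=> psi; rewrite /restrict_type /tp /=; last first.
  move=> psiM; rewrite indicator1 ?rmorph1// => C.
  exact/(realizes_relativize _ _ UR).
move=> h; apply: contrapT => npsi; move: h; rewrite indicator0 ?rmorph0.
  by move=> /eqP; rewrite eq_sym oner_eq0.
by move=> C /(realizes_relativize _ _ UR).
Qed.

End MorphismType.

(** The cofactor is the inverse of [f - l] cut off to [[phi]].  It is uniformly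
    continuous since [[phi]] is a union of stabilizer orbits, and inversion is
    Lipschitz away from [0]. *)
Lemma local_inverse (f : buc K X) (l d : K) phi : 0 < d ->
  (forall C, realizes phi C -> d <= `|f C - l|) ->
  exists g : buc K X, (f - l *: 1) * g = indicator phi.
Proof.
move=> d0 fl.
pose g (C : X) : K^o := if `[< realizes phi C >] then (f C - l)^-1 else 0.
have fl0 C : realizes phi C -> 0 < `|f C - l| by move=> /fl; exact: lt_le_trans.
have gP : g \in @bdd_ucont K X.
  apply/asboolP; split.
    exists d^-1 => C; rewrite /g; case: asboolP => [phiC|_].
      by rewrite normfV lef_pV2 ?posrE ?fl0 ?fl.
    by rewrite normr0 invr_ge0 ltW.
  apply/unif_continuousE => e e0; have [k [c cP]] := realizes_fixes iota phi.
  have same : entourage [set CD : X * X | realizes phi CD.2 <-> realizes phi CD.1].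
    by apply/entourage_fixes; exists k, c => v C; exact: cP.
  have ed0 : 0 < e * (d * d) by rewrite !mulr_gt0.
  have /asboolP[_ /unif_continuousE/(_ _ ed0) fu] := buc_funP f.
  apply: filterS (filterI same fu) => -[C D] /= [CD fCD].
  rewrite /g (asbool_equiv_eq CD); case: asboolP => [phiC|_]; last first.
    by rewrite subrr normr0.
  have phiD : realizes phi D by apply/CD.
  have C0 := fl0 _ phiC; have D0 := fl0 _ phiD.
  have -> : (f C - l)^-1 - (f D - l)^-1 = (f D - f C) / ((f C - l) * (f D - l)).
    by field; rewrite -!normr_gt0 C0 D0.
  rewrite normrM normfV normrM distrC ltr_pdivrMr ?mulr_gt0//.
  rewrite (lt_le_trans fCD)// ler_pM2l//.
  by apply: ler_pM; rewrite ?(ltW d0) ?fl.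
exists (Buc gP); apply: val_inj; apply/funext => C.
rewrite -[LHS]/((f C - l * 1) * g C) -[RHS]/(indicator phi C) indicatorE /g mulr1.
by case: asboolP => [/fl0|_]; rewrite ?mulr0// normr_gt0 => /mulfV.
Qed.

(** If [f] were not close to [chi f] at one coset realizing a formula of small
    oscillation, it would stay away from [chi f] at all of them, and
    [local_inverse] would write an indicator of value [1] as a multiple of
    [f - chi f]. *)
Lemma morphism_corresponds (chi : {lrmorphism buc K X -> K | *%R}) :
  corresponds chi (morphism_type chi).
Proof.
move=> f; have chiE := morphism_type_Exp chi; have chiF := type_filter_proper chiE.
apply/cvgrPdist_lt => e e0; have e2 : 0 < e / 2 by rewrite divr_gt0.
have [phi phi1 osc] := small_oscillation cM aM exp fN f Kcells chiE e2.
exists phi => // D phiD /=.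
apply: contrapT => /negP; rewrite -real_leNgt ?(gtr0_real e0) ?normr_real// => far.
have [|g] := local_inverse (l := chi f) e2 (f := f) (phi := phi).
  move=> C phiC; rewrite distrC -(lerD2r (e / 2)) -splitr (le_trans far)//.
  rewrite (le_trans (ler_distD (f C) _ _))// lerD2l.
  by apply: ltW; exact: osc.
move=> /(congr1 chi); rewrite rmorphM rmorphB /= linearZ /= rmorph1 mulr1.
by rewrite subrr mul0r phi1 => /eqP; rewrite eq_sym oner_eq0.
Qed.

Lemma corresponds_indicator (chi : samuel K X) (p : Ntypes) phi : Exp iota p ->
  corresponds chi p -> (p : set nform) phi <-> chi (indicator phi) = 1.
Proof.
move=> pE chip; have pF := type_filter_proper pE.
have limE (l : K) : (indicator phi : X -> K^o) @ type_filter p --> (l : K^o) ->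
    chi (indicator phi) = l.
  by move=> liml; apply: (cvg_unique _ (chip (indicator phi)) liml).
split=> [pphi|chi1].
  apply: limE; apply/cvgrPdist_lt => e e0; exists phi => // C phiC /=.
  by rewrite asboolT// subrr normr0.
apply: contrapT => /(complete_type_Neg _ (type_setP p)) pN.
suff : chi (indicator phi) = 0 by rewrite chi1 => /eqP; rewrite oner_eq0.
apply: limE; apply/cvgrPdist_lt => e e0; exists (Neg phi) => // C.
by move=> /realizes_Neg nphiC /=; rewrite asboolF// subrr normr0.
Qed.

(** Equivariance, on the level of indicators: [(g * k)^-1 a = k^-1 (g^-1 a)]. *)
Lemma indicator_translate g phi :
  buc_comp (@translate_unif_continuous _ M H g) (indicator phi) =
  indicator (rename (map_vars (S := expanded E) (g^-1%g tt)) phi).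
Proof.
apply: val_inj; apply/funext => C; have [k ->] := cosetE C.
rewrite -[LHS]/(indicator phi (translate g (lcoset H k))).
rewrite -[RHS]/(indicator _ (lcoset H k)).
rewrite !indicatorE translate_lcoset; congr (if _ then _ else _).
apply: asbool_equiv_eq; rewrite !realizes_lcoset sat_map_vars.
suff -> : translated iota (g * k)%g = translated iota k \o g^-1%g tt by [].
by apply/funext => a; rewrite /translated invgM.
Qed.

Lemma samuel_ext (chi chi' : samuel K X) : chi =1 chi' -> chi = chi'.
Proof.
case: chi chi' => f cf [f' cf'] /= ff'.
have e : f = f' by apply/funext.
subst f'; congr (GRing.LRMorphism.Pack _).
case: cf cf' => [[a] [b] [c]] [[a'] [b'] [c']].
by rewrite (Prop_irrelevance a a') (Prop_irrelevance b b') (Prop_irrelevance c c').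
Qed.

Lemma samuel_eval_continuous (f : buc K X) :
  continuous (fun chi : samuel K X => chi f : K^o).
Proof.
move=> chi; apply: (@continuous_comp _ {ptws buc K X -> K} _
  (fun (chi : samuel K X) (f : buc K X) => chi f : K) (fun h => h f)).
  exact: initial_continuous.
exact: (@proj_continuous _ (fun _ : buc K X => K) f).
Qed.

Lemma continuous_samuel (T : topologicalType) (F : T -> samuel K X) :
  (forall f, continuous (fun t => F t f : K^o)) -> continuous F.
Proof.
move=> Fc; apply: continuous_comp_initial => t.
apply/cvg_sup => f; apply/cvg_image.
  by rewrite eqEsubset; split=> // y _; exists (cst y).
move=> W /(Fc f t) Wt; exists ((fun h : buc K X -> K => h f) @^-1` W) => //.
by rewrite image_preimage // eqEsubset; split=> // y _; exists (cst y).
Qed.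

Lemma samuel_Exp_isomorphic :
  isomorphic_actions (@samuel_act K (one_sorted L) M H) (@Exp_act L E M N iota).
Proof.
have toSa_ex (p : Exp iota) : exists chi : samuel K X, corresponds chi (val p).
  exact: (type_morphism (set_valP p)).
pose toSa p := projT1 (cid (toSa_ex p)).
have toSaP p : corresponds (toSa p) (val p) := projT2 (cid (toSa_ex p)).
pose toExp (chi : samuel K (coset_space (aut_expansion iota))) : Exp iota :=
  SigSub (mem_set (morphism_type_Exp chi)).
have toExpP chi : corresponds chi (val (toExp chi)).
  exact: morphism_corresponds.
have ExpP (p : Exp iota) : Exp iota (val p) by exact: set_valP.
exists toExp, toSa; split.
- move=> chi; apply: samuel_ext => f.
  have pF := type_filter_proper (ExpP (toExp chi)).
  exact: (cvg_unique _ (toSaP (toExp chi) f) (toExpP chi f)).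
- move=> p; apply: val_inj; apply: types_eq; apply/seteqP; split=> phi.
    by move/(corresponds_indicator phi (ExpP p) (toSaP p)).
  by move=> pphi; apply/(corresponds_indicator phi (ExpP p) (toSaP p)).
- apply: continuous_comp_initial => chi A; rewrite nbhsE => -[B [oB Bchi] BA].
  have [phi phi1 phiB] := oB _ Bchi.
  have half : 0 < 1 / 2 :> K by rewrite divr_gt0.
  have /cvgrPdist_lt/(_ _ half) := @samuel_eval_continuous (indicator phi) chi.
  apply: filterS => chi' /=; rewrite phi1 => close; apply/BA/phiB => /=.
  have [//|chi'0] := indicator01 chi' phi; move: close.
  by rewrite chi'0 subr0 normr1 ltr_pdivlMr// mul1r ltrn1.
- suff cts f : continuous (fun p : Exp iota => toSa p f : K^o).
    exact: continuous_samuel.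
  move=> p; apply/(cvgrPdist_lt (FF := nbhs_filter p)) => e e0.
  have e2 : 0 < e / 2 by rewrite divr_gt0.
  have pF := type_filter_proper (ExpP p).
  have /cvgrPdist_lt/(_ _ e2)[phi pphi phif] := toSaP p f.
  have : nbhs (p : Exp iota) [set q : Exp iota | type_set (val q) phi].
    apply: (@initial_continuous (Exp iota) _ set_val p
      [set q : Ntypes | type_set q phi]).
    by apply: open_nbhs_nbhs; split; [move=> q qphi; exists phi|].
  move=> /filterS; apply=> q qphi.
  have qF := type_filter_proper (ExpP q).
  have /cvgrPdist_lt/(_ _ e2) qf := toSaP q f.
  have phiq : type_filter (val q) [set C : X | realizes phi C] by exists phi.
  have [C [/phif pC qC]] := filter_ex (filterI phiq qf).
  rewrite [e]splitr (le_lt_trans (ler_distD (f C) _ _))// ltrD//.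
  by rewrite distrC.
- move=> g chi; apply: val_inj; apply: types_eq; apply/funext => phi.
  rewrite -[LHS]/(chi (buc_comp (@translate_unif_continuous _ M H g)
    (indicator phi)) = 1).
  by rewrite indicator_translate.
Qed.

End Correspondence.

Theorem proposition3p5 (R : realType) (L : language) (E : extension L)
    (M : structure (one_sorted L)) (N : structure (expanded E))
    (iota : M tt -> N None) :
  countable [set: M tt] ->
  atomic M ->
  expansion iota ->
  full N ->
  isomorphic_actions
    (@samuel_act R[i] (one_sorted L) M (aut_expansion iota))
    (@Exp_act L E M N iota).
Proof.
move=> cM aM exp fN; apply: samuel_Exp_isomorphic => //.
- exact: complex_bounded_sets_subdivide.
- exact: complex_cauchy_filters_converge.
Qed.
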